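(* Assume $( * )$. Then there is a compactification $\gamma\omega$ of the discrete space $\omega$ such that the remainder $\gamma\omega\setminus\omega$ is not separable but carries a strictly positive regular probability Borel measure, i.e.\ a regular Borel probability measure that is positive on every nonempty open subset of $\gamma\omega\setminus\omega$.
   Context: Let $\lambda$ be the standard product measure on the Cantor set $2^\omega$. Let $\mathcal E$ be the ideal of all sets $A\subseteq 2^\omega$ with $\lambda(\overline{A})=0$, and let $\kappa_0=\mathrm{cov}(\mathcal E)$ be the least cardinality of a family of sets from $\mathcal E$ covering $2^\omega$. Let $\mathrm{cof}[\kappa_0]^{\le\omega}$ be the least size of a family $\mathcal J$ of countable subsets of $\kappa_0$ such that every countable subset of $\kappa_0$ is contained in some member of $\mathcal J$. Let $\mathfrak b$ be the bounding number. The hypothesis $( * )$ is: $\mathrm{cof}[\kappa_0]^{\le\omega}\le\mathfrak b$. *)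

(* Defs.v *)
From Stdlib Require Import Reals List.
Open Scope R_scope.

Definition injects (A B : Type) : Prop :=
  exists f : A -> B, forall a a', f a = f a' -> a = a'.

Definition countable_sub {K : Type} (S : K -> Prop) : Prop :=
  exists f : nat -> option K, forall k, S k -> exists n, f n = Some k.

Definition cantor := nat -> bool.

Definition agree (x y : cantor) (n : nat) : Prop :=
  forall i, (i < n)%nat -> x i = y i.

Definition cl (A : cantor -> Prop) : cantor -> Prop :=
  fun x => forall n, exists y, A y /\ agree x y n.

Definition in_cyl (s : list bool) (x : cantor) : Prop :=
  forall i, (i < length s)%nat -> nth i s false = x i.

(* lambda-outer-measure zero: lambda^*(A) = inf of sum_k 2^-|s_k| over
   countable covers of A by cylinders [s_k]; lambda^*(A) = 0 iff for every
   eps > 0 there is such a cover of total weight <= eps. *)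
Definition lambda_null (A : cantor -> Prop) : Prop :=
  forall eps, 0 < eps ->
    exists s : nat -> list bool,
      (forall x, A x -> exists k, in_cyl (s k) x) /\
      (forall N, sum_f_R0 (fun k => (/ 2) ^ length (s k)) N <= eps).

Definition in_E (A : cantor -> Prop) : Prop := lambda_null (cl A).

Definition covers_E (K : Type) (c : K -> cantor -> Prop) : Prop :=
  (forall k, in_E (c k)) /\ (forall x, exists k, c k x).

(* K has cardinality kappa_0 = cov(E): K indexes a cover of 2^omega by
   E-sets, and K injects into the index set of every such cover. *)
Definition is_covE (K : Type) : Prop :=
  exists c, covers_E K c /\
    forall (K' : Type) (c' : K' -> cantor -> Prop), covers_E K' c' -> injects K K'.

Definition cofinal_countable (K J : Type) (js : J -> K -> Prop) : Prop :=
  (forall j, countable_sub (js j)) /\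
  (forall S : K -> Prop, countable_sub S -> exists j, forall k, S k -> js j k).

Definition unbounded (F : Type) (f : F -> nat -> nat) : Prop :=
  ~ exists g : nat -> nat,
      forall i, exists m, forall n, (m <= n)%nat -> (f i n <= g n)%nat.

Definition le_bounding (J : Type) : Prop :=
  forall (F : Type) (f : F -> nat -> nat), unbounded F f -> injects J F.

(* hypothesis ( * ):  cof [kappa_0]^{<=omega} <= b *)
Definition hyp_star : Prop :=
  exists K : Type, is_covE K /\
    exists (J : Type) (js : J -> K -> Prop), cofinal_countable K J js /\ le_bounding J.

Definition is_topology {X : Type} (op : (X -> Prop) -> Prop) : Prop :=
  op (fun _ => True) /\
  (forall U V, op U -> op V -> op (fun x => U x /\ V x)) /\
  (forall (I : Type) (F : I -> X -> Prop),
      (forall i, op (F i)) -> op (fun x => exists i, F i x)).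

Definition closed {X : Type} (op : (X -> Prop) -> Prop) (C : X -> Prop) : Prop :=
  op (fun x => ~ C x).

Definition compact {X : Type} (op : (X -> Prop) -> Prop) : Prop :=
  forall (I : Type) (F : I -> X -> Prop),
    (forall i, op (F i)) -> (forall x, exists i, F i x) ->
    exists l : list I, forall x, exists i, In i l /\ F i x.

Definition hausdorff {X : Type} (op : (X -> Prop) -> Prop) : Prop :=
  forall x y, x <> y -> exists U V, op U /\ op V /\ U x /\ V y /\
    forall z, ~ (U z /\ V z).

Definition dense {X : Type} (op : (X -> Prop) -> Prop) (D : X -> Prop) : Prop :=
  forall U, op U -> (exists x, U x) -> exists x, U x /\ D x.

Definition subspace_top {X : Type} (op : (X -> Prop) -> Prop) (P : X -> Prop)
  : ({x | P x} -> Prop) -> Prop :=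
  fun V => exists U, op U /\ forall y : {x | P x}, V y <-> U (proj1_sig y).

Definition separable {X : Type} (op : (X -> Prop) -> Prop) : Prop :=
  exists s : nat -> option X, dense op (fun x => exists n, s n = Some x).

Definition compactification_of_omega {X : Type} (op : (X -> Prop) -> Prop)
  (e : nat -> X) : Prop :=
  is_topology op /\ compact op /\ hausdorff op /\
  (forall n m, e n = e m -> n = m) /\
  (forall n, op (fun x => x = e n)) /\
  dense op (fun x => exists n, e n = x).

Definition borel {Y : Type} (op : (Y -> Prop) -> Prop) (B : Y -> Prop) : Prop :=
  forall S : (Y -> Prop) -> Prop,
    (forall U, op U -> S U) ->
    (forall A, S A -> S (fun y => ~ A y)) ->
    (forall A : nat -> Y -> Prop, (forall n, S (A n)) -> S (fun y => exists n, A n y)) ->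
    S B.

Definition borel_prob_measure {Y : Type} (op : (Y -> Prop) -> Prop)
  (mu : (Y -> Prop) -> R) : Prop :=
  mu (fun _ => True) = 1 /\
  (forall B, borel op B -> 0 <= mu B) /\
  (forall A : nat -> Y -> Prop,
     (forall n, borel op (A n)) ->
     (forall n m y, n <> m -> A n y -> A m y -> False) ->
     infinite_sum (fun n => mu (A n)) (mu (fun y => exists n, A n y))).

Definition regular_measure {Y : Type} (op : (Y -> Prop) -> Prop)
  (mu : (Y -> Prop) -> R) : Prop :=
  forall B, borel op B -> forall eps, 0 < eps ->
    (exists U, op U /\ (forall y, B y -> U y) /\ mu U <= mu B + eps) /\
    (exists C, closed op C /\ (forall y, C y -> B y) /\ mu B - eps <= mu C).

Definition strictly_positive {Y : Type} (op : (Y -> Prop) -> Prop)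
  (mu : (Y -> Prop) -> R) : Prop :=
  forall U, op U -> (exists y, U y) -> 0 < mu U.

(* Main.v *)
(** An integer [N] is read as the point of the Cantor space given by its binary digits, and
    sets of integers are measured by their density in the intervals [[0, 2^n)].  If [A] is an
    algebra of sets of integers that contains the singletons and the sets fixed by one digit,
    and on which the density exists and vanishes only at finite sets, then the Stone space of
    [A] is a compactification of omega and the density induces a strictly positive regular
    measure on its remainder, which maps onto the Cantor space.

    [A] is generated by sets [Y_j], one for each member [j] of a cofinal family of countable
    sets of indices of closed null sets [F_k]; [Y_j] is almost equal to a union of
    neighbourhoods of the [F_k] with [k] in [j], of measure at most 1/2.  The complement of
    [Y_j] then gives a nonempty open set in the remainder missing every point that lies over
    the union of these [F_k], so no countable set is dense.  The [Y_j] are chosen by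
    transfinite recursion.  Since fewer than b sets precede [Y_j], one function dominates what
    they all require of the sizes of the neighbourhoods: the k-th one is, for almost all k,
    disjoint from the old set [a] as soon as some smaller neighbourhood is almost disjoint
    from it, and it is negligible against what the previous ones left of [a].  Therefore no
    infinite set of density zero arises. *)

Require Import Defs.
From Stdlib Require Import Reals List Lra Lia Classical ClassicalEpsilon.
From Stdlib Require Import FunctionalExtensionality PropExtensionality Wellfounded.
From Stdlib Require Cantor.
From mathcomp Require boolp wochoice filter.
Set Bullet Behavior "Strict Subproofs".
Open Scope R_scope.

(** * Ultrafilters and well-orders *)

Lemma pred_ext {T : Type} (A B : T -> Prop) : (forall x, A x <-> B x) -> A = B.
Proof.
  intros H. apply functional_extensionality. intros x.
  apply propositional_extensionality. apply H.
Qed.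

Record ultra {T : Type} (u : (T -> Prop) -> Prop) : Prop := {
  ultra_ex : forall a, u a -> exists x, a x;
  ultra_and : forall a b, u a -> u b -> u (fun x => a x /\ b x);
  ultra_up : forall a b : T -> Prop, (forall x, a x -> b x) -> u a -> u b;
  ultra_em : forall a, u a \/ u (fun x => ~ a x) }.

(** The finite intersection property makes the filter generated by [F] proper, and a maximal proper
    filter above it decides every set. *)
Lemma ultra_extend {T : Type} (F : (T -> Prop) -> Prop) :
  (forall l, (forall a, In a l -> F a) -> exists x, forall a, In a l -> a x) ->
  exists u, ultra u /\ forall a, F a -> u a.
Proof.
  intros FIP.
  set (G := fun a : T -> Prop =>
    exists l, (forall b, In b l -> F b) /\
      forall x, (forall b, In b l -> b x) -> a x).
  assert (PG : filter.ProperFilter G).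
  { constructor.
    - intros [l [Hl H]]. destruct (FIP l Hl) as [x Hx]. exact (H x Hx).
    - constructor.
      + exists nil. split; [intros b []|]. intros; exact I.
      + intros a b [l [Hl Ha]] [m [Hm Hb]]. exists (l ++ m). split.
        * intros c Hc. apply in_app_or in Hc. destruct Hc; auto.
        * intros x Hx. split; [apply Ha|apply Hb];
            intros c Hc; apply Hx, in_or_app; auto.
      + intros a b Hab [l [Hl H]]. exists l. split; [exact Hl|].
        intros x Hx. apply Hab, H, Hx. }
  destruct (filter.ultraFilterLemma PG) as [u [Uu Gu]].
  destruct Uu as [Pu Mu]. pose proof Pu as [Nu Fu].
  destruct Fu as [Tu Iu Su].
  exists u. split.
  - constructor.
    + intros a Ha. apply NNPP. intros N. apply Nu.
      refine (Su a _ _ Ha). intros x Hx. apply N. exists x. exact Hx.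
    + intros a b Ha Hb. exact (Iu a b Ha Hb).
    + intros a b Hab Ha. exact (Su a b Hab Ha).
    + intros a. destruct (classic (u (fun x => ~ a x))) as [|Hn]; [now right|left].
      (* The filter generated by [u] and [a] is proper because the complement of [a] is not in [u];
         maximality of [u] then puts [a] into [u]. *)
      set (H := fun b : T -> Prop => exists c, u c /\ forall x, c x -> a x -> b x).
      assert (PH : filter.ProperFilter H).
      { constructor.
        - intros [c [Hc Hca]]. apply Hn. refine (Su c _ _ Hc).
          intros x Hx Ha. exact (Hca x Hx Ha).
        - constructor.
          + exists (fun _ => True). split; [exact Tu|]. intros; exact I.
          + intros b b' [c [Hc H1]] [c' [Hc' H2]].
            exists (fun x => c x /\ c' x). split; [exact (Iu c c' Hc Hc')|].
            intros x [h h'] ha. split; [now apply H1|now apply H2].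
          + intros b b' Hb [c [Hc H1]]. exists c. split; [exact Hc|].
            intros x h ha. apply Hb, H1; auto. }
      rewrite <- (Mu H PH).
      * exists (fun _ => True). split; [exact Tu|auto].
      * intros b Hb. exists b. auto.
  - intros a Ha. apply Gu. exists (cons a nil). split.
    + intros b [<-|[]]. exact Ha.
    + intros x Hx. apply Hx. now left.
Qed.

Lemma well_order_exists (T : Type) : exists lt : T -> T -> Prop,
  well_founded lt /\ (forall x y, lt x y \/ x = y \/ lt y x) /\
  (forall x y z, lt x y -> lt y z -> lt x z).
Proof.
  destruct (wochoice.well_ordering_principle (boolp.boolp_classicType__canonical__eqtype_Equality T)) as [R W].
  simpl in *.
  assert (M : forall A : T -> Prop, (exists x, A x) ->
    exists z, (A z /\ forall x, A x -> R z x = true) /\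
      forall z', (A z' /\ forall x, A x -> R z' x = true) -> z = z').
  { intros A [x Hx].
    destruct (W (fun x => boolp.asbool (A x))) as [z [[Hz1 Hz2] Hz3]].
    { exists x. apply boolp.asboolT. exact Hx. }
    exists z. split.
    - split.
      + apply boolp.asboolW. exact Hz1.
      + intros y Hy. apply Hz2. apply boolp.asboolT. exact Hy.
    - intros z' [H1 H2]. apply Hz3. split.
      + apply boolp.asboolT. exact H1.
      + intros y Hy. apply H2. apply boolp.asboolW. exact Hy. }
  (* [R] is reflexive, so strictly below is rendered as failure of the reversed relation. Applied to
     sets of one, two and three points, the unique minima of [M] give reflexivity, totality and
     transitivity. *)
  exists (fun x y => R y x <> true).
  assert (Wf : well_founded (fun x y => R y x <> true)).
  { intros x. apply NNPP. intros N.
    destruct (M (fun x => ~ Acc (fun x y => R y x <> true) x)) as [z [[H1 H2] _]].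
    { now exists x. }
    apply H1. constructor. intros y Hy. apply NNPP. intros Ny.
    apply Hy, H2, Ny. }
  assert (Rf : forall x, R x x = true).
  { intros x. destruct (M (fun y => y = x)) as [z [[H1 H2] _]]; [now exists x|].
    subst z. now apply H2. }
  assert (To : forall x y, R y x <> true \/ x = y \/ R x y <> true).
  { intros x y. destruct (R y x) eqn:E1; [|left; discriminate].
    destruct (R x y) eqn:E2; [|right; right; discriminate].
    right; left.
    destruct (M (fun z => z = x \/ z = y)) as [z [[H1 H2] H3]]; [now exists x; left|].
    transitivity z; [symmetry|]; apply H3; split; auto;
      intros w [-> | ->]; auto. }
  split; [exact Wf|split; [exact To|]].
  intros x y z Hxy Hyz. intros E.
  destruct (M (fun w => w = x \/ w = y \/ w = z)) as [w [[H1 H2] H3]]; [exists x; auto|].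
  destruct H1 as [-> | [-> | ->]].
  - assert (z = x) by (destruct (To x z) as [?|[?|?]]; [contradiction|auto|]; exfalso; auto).
    subst z. apply Hyz. apply H2. auto.
  - apply Hxy. apply H2. auto.
  - apply Hyz. apply H2. auto.
Qed.

(** * Density along initial segments of length [2 ^ n] *)

Fixpoint cnt (a : nat -> Prop) (n : nat) : nat :=
  match n with
  | O => O
  | S n => (cnt a n + if excluded_middle_informative (a n) then 1 else 0)%nat
  end.

Lemma cnt_le a b n : (forall N, (N < n)%nat -> a N -> b N) -> (cnt a n <= cnt b n)%nat.
Proof.
  induction n as [|n IH]; simpl; intros H; auto.
  assert (cnt a n <= cnt b n)%nat by (apply IH; intros; apply H; auto).
  destruct (excluded_middle_informative (a n)) as [h|h];
  destruct (excluded_middle_informative (b n)) as [h'|h']; try lia.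
  exfalso. apply h', H; auto.
Qed.

Lemma cnt_ext a b n : (forall N, (N < n)%nat -> (a N <-> b N)) -> cnt a n = cnt b n.
Proof. intros H. apply Nat.le_antisymm; apply cnt_le; intros; now apply H. Qed.

Lemma cnt_or_le a b n : (cnt (fun N => a N \/ b N) n <= cnt a n + cnt b n)%nat.
Proof.
  induction n as [|n IH]; simpl; auto.
  destruct (excluded_middle_informative (a n)) as [h|h];
  destruct (excluded_middle_informative (b n)) as [h'|h'];
  destruct (excluded_middle_informative (a n \/ b n)) as [h''|h'']; try lia; tauto.
Qed.

Lemma cnt_or_eq a b n : (forall N, a N -> b N -> False) ->
  cnt (fun N => a N \/ b N) n = (cnt a n + cnt b n)%nat.
Proof.
  intros H. induction n as [|n IH]; simpl; auto. rewrite IH.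
  destruct (excluded_middle_informative (a n)) as [h|h];
  destruct (excluded_middle_informative (b n)) as [h'|h'];
  destruct (excluded_middle_informative (a n \/ b n)) as [h''|h'']; try lia; try tauto.
  exfalso. eauto.
Qed.

Lemma cnt_plus a m n : cnt a (m + n) = (cnt a m + cnt (fun N => a (m + N)) n)%nat.
Proof.
  induction n as [|n IH]; simpl.
  - now rewrite !Nat.add_0_r.
  - rewrite Nat.add_succ_r. simpl. rewrite IH.
    destruct (excluded_middle_informative (a (m + n)%nat)); lia.
Qed.

Lemma cnt_bounded a B n : (forall N, a N -> (N < B)%nat) -> (cnt a n <= B)%nat.
Proof.
  intros H. induction n as [|n IH]; simpl; [lia|].
  destruct (excluded_middle_informative (a n)) as [h|h]; [|lia].
  specialize (H n h). assert (forall m, (cnt a m <= m)%nat).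
  { induction m; simpl; auto. destruct (excluded_middle_informative (a m)); lia. }
  specialize (H0 n). lia.
Qed.

Lemma cnt_full n : cnt (fun _ => True) n = n.
Proof.
  induction n as [|n IH]; simpl; auto. rewrite IH.
  destruct (excluded_middle_informative True); [lia|tauto].
Qed.

Definition dens (a : nat -> Prop) (n : nat) : R := INR (cnt a (2 ^ n)) / 2 ^ n.

Lemma pow2_pos n : 0 < 2 ^ n.
Proof. apply pow_lt. lra. Qed.

Lemma INR_pow2 n : INR (2 ^ n) = 2 ^ n.
Proof. rewrite pow_INR. reflexivity. Qed.

Lemma dens_le a b n : (forall N, (N < 2 ^ n)%nat -> a N -> b N) -> dens a n <= dens b n.
Proof.
  intros H. apply Rmult_le_compat_r.
  - apply Rlt_le, Rinv_0_lt_compat, pow2_pos.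
  - apply le_INR, cnt_le, H.
Qed.

Lemma dens_nonneg a n : 0 <= dens a n.
Proof.
  apply Rmult_le_pos; [apply pos_INR|]. apply Rlt_le, Rinv_0_lt_compat, pow2_pos.
Qed.

Lemma dens_or_le a b n : dens (fun N => a N \/ b N) n <= dens a n + dens b n.
Proof.
  unfold dens. rewrite <- Rdiv_plus_distr. apply Rmult_le_compat_r.
  - apply Rlt_le, Rinv_0_lt_compat, pow2_pos.
  - rewrite <- plus_INR. apply le_INR, cnt_or_le.
Qed.

Lemma dens_or_eq a b n : (forall N, a N -> b N -> False) ->
  dens (fun N => a N \/ b N) n = dens a n + dens b n.
Proof. intros H. unfold dens. rewrite cnt_or_eq, plus_INR by auto. lra. Qed.

Lemma dens_full n : dens (fun _ => True) n = 1.
Proof.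
  unfold dens. rewrite cnt_full, INR_pow2. field. apply Rgt_not_eq, pow2_pos.
Qed.

(** * Sets of integers determined by finitely many binary digits *)

Definition bits (N : nat) : cantor := fun i => Nat.testbit N i.

Definition dep (m : nat) (c : nat -> Prop) : Prop :=
  forall N N', agree (bits N) (bits N') m -> c N -> c N'.

Lemma agree_sym x y n : agree x y n -> agree y x n.
Proof. intros H i Hi. symmetry. auto. Qed.

Lemma agree_trans x y z n : agree x y n -> agree y z n -> agree x z n.
Proof. intros H H' i Hi. rewrite H; auto. Qed.

Lemma agree_le x y n m : (m <= n)%nat -> agree x y n -> agree x y m.
Proof. intros H H' i Hi. apply H'. lia. Qed.

Lemma agree_mod N m : agree (bits N) (bits (N mod 2 ^ m)) m.
Proof. intros i Hi. unfold bits. now rewrite Nat.mod_pow2_bits_low. Qed.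

Lemma agree_lt_eq N N' m : (N < 2 ^ m)%nat -> (N' < 2 ^ m)%nat ->
  agree (bits N) (bits N') m -> N = N'.
Proof.
  intros H H' Ha. apply Nat.bits_inj. intros i.
  destruct (Nat.lt_ge_cases i m) as [L|L].
  - now apply Ha.
  - rewrite <- (Nat.mod_small N (2 ^ m)), <- (Nat.mod_small N' (2 ^ m)) by auto.
    now rewrite !Nat.mod_pow2_bits_high.
Qed.

Lemma dep_S m c : dep m c -> dep (S m) c.
Proof. intros H N N' Ha. apply H. apply (agree_le _ _ (S m)); auto. Qed.

Lemma dep_le m n c : (m <= n)%nat -> dep m c -> dep n c.
Proof. induction 1; auto. intros. apply dep_S; auto. Qed.

Lemma dep_not m c : dep m c -> dep m (fun N => ~ c N).
Proof. intros H N N' Ha Hn Hc. apply Hn. apply (H N'); auto using agree_sym. Qed.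

Lemma dep_and m c d : dep m c -> dep m d -> dep m (fun N => c N /\ d N).
Proof. intros H H' N N' Ha []. split; eauto. Qed.

(** Adding [2 ^ m] leaves the first [m] digits unchanged, so the second half of the longer interval
    repeats the first. *)
Lemma dens_dep_S m c : dep m c -> dens c (S m) = dens c m.
Proof.
  intros H. unfold dens.
  replace (2 ^ S m)%nat with (2 ^ m + 2 ^ m)%nat by (simpl; lia).
  rewrite cnt_plus.
  rewrite (cnt_ext (fun N => c (2 ^ m + N)%nat) c).
  - rewrite plus_INR. simpl. field. apply Rgt_not_eq, pow2_pos.
  - intros N HN.
    assert (Ha : agree (bits (2 ^ m + N)) (bits N) m).
    { eapply agree_trans; [apply agree_mod|].
      apply agree_sym. eapply agree_trans; [apply agree_mod|].
      replace ((2 ^ m + N) mod 2 ^ m)%nat with (N mod 2 ^ m)%nat; [intros i Hi; auto|].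
      rewrite <- (Nat.mul_1_l (2 ^ m)) at 2. rewrite Nat.add_comm.
      now rewrite Nat.Div0.mod_add. }
    split; apply H; auto using agree_sym.
Qed.

Lemma dens_dep m n c : dep m c -> (m <= n)%nat -> dens c n = dens c m.
Proof.
  intros H. induction 1 as [|n Hn IH]; auto. rewrite <- IH. apply dens_dep_S.
  now apply (dep_le m).
Qed.

(** * Sets approximable by clopen ones, and their measure *)

Definition symdiff (a c : nat -> Prop) : nat -> Prop := fun N => ~ (a N <-> c N).

Definition dens_lim_le (a : nat -> Prop) (e : R) : Prop :=
  exists n0, forall n, (n0 <= n)%nat -> dens a n <= e.

(* An analogue of Jordan measurability, closed under Boolean operations, whereas mere
   existence of the density is not. *)
Definition appr (a : nat -> Prop) : Prop :=
  forall e, 0 < e -> exists m c, dep m c /\ dens_lim_le (symdiff a c) e.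

Definition fin (a : nat -> Prop) : Prop := exists B, forall N, a N -> (N < B)%nat.

Lemma fin_or a b : fin a -> fin b -> fin (fun N => a N \/ b N).
Proof.
  intros [A HA] [B HB]. exists (max A B). intros N [H|H].
  - specialize (HA N H). lia.
  - specialize (HB N H). lia.
Qed.

Lemma fin_sub a b : (forall N, a N -> b N) -> fin b -> fin a.
Proof. intros H [B HB]. exists B. auto. Qed.

Lemma dens_lim_le_sub a b e :
  (forall N, a N -> b N) -> dens_lim_le b e -> dens_lim_le a e.
Proof.
  intros H [n0 Hn]. exists n0. intros n L.
  eapply Rle_trans; [|apply (Hn n L)]. apply dens_le. auto.
Qed.

Lemma dens_lim_le_or a b e f :
  dens_lim_le a e -> dens_lim_le b f -> dens_lim_le (fun N => a N \/ b N) (e + f).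
Proof.
  intros [n0 Hn] [m0 Hm]. exists (max n0 m0). intros n L.
  eapply Rle_trans; [apply dens_or_le|]. apply Rplus_le_compat; [apply Hn|apply Hm]; lia.
Qed.

Lemma pow2_unbounded r : exists n0, forall n, (n0 <= n)%nat -> r < 2 ^ n.
Proof.
  destruct (INR_unbounded r) as [n0 H]. exists n0. intros n L.
  apply Rlt_le_trans with (INR n0); [lra|]. apply Rle_trans with (INR n); [now apply le_INR|].
  rewrite <- INR_pow2. apply le_INR. apply Nat.lt_le_incl, Nat.pow_gt_lin_r. lia.
Qed.

Lemma dens_lim_le_fin a e : fin a -> 0 < e -> dens_lim_le a e.
Proof.
  intros [B HB] He. destruct (pow2_unbounded (INR B / e)) as [n0 Hn].
  exists n0. intros n L. specialize (Hn n L).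
  apply Rle_trans with (INR B / 2 ^ n).
  - apply Rmult_le_compat_r; [apply Rlt_le, Rinv_0_lt_compat, pow2_pos|].
    apply le_INR. now apply cnt_bounded.
  - pose proof (pow2_pos n).
    apply (Rmult_le_reg_r (2 ^ n)); auto. unfold Rdiv. rewrite Rmult_assoc, Rinv_l by lra.
    apply (Rmult_lt_compat_r e) in Hn; auto. unfold Rdiv in Hn.
    rewrite Rmult_assoc, Rinv_l in Hn; lra.
Qed.

Lemma appr_dep m c : dep m c -> appr c.
Proof.
  intros H e He. exists m, c. split; auto. apply dens_lim_le_fin; auto.
  exists 0%nat. intros N HN. exfalso. apply HN. tauto.
Qed.

(** Admits infinite unions whose tails have small density, such as the sets adjoined in the
    recursion. *)
Lemma appr_limit a :
  (forall e, 0 < e -> exists c, appr c /\ dens_lim_le (symdiff a c) e) -> appr a.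
Proof.
  intros H e He. destruct (H (e / 2)) as [c [Hc Hac]]; [lra|].
  destruct (Hc (e / 2)) as [m [d [Hd Hcd]]]; [lra|].
  exists m, d. split; auto. replace e with (e / 2 + e / 2) by field.
  eapply dens_lim_le_sub; [|apply dens_lim_le_or; [apply Hac|apply Hcd]].
  intros N HN. unfold symdiff in *.
  destruct (classic (a N <-> c N)); [right|left]; tauto.
Qed.

Lemma appr_not a : appr a -> appr (fun N => ~ a N).
Proof.
  intros H e He. destruct (H e He) as [m [c [Hc Hd]]].
  exists m, (fun N => ~ c N). split; [now apply dep_not|].
  eapply dens_lim_le_sub; [|apply Hd]. unfold symdiff. intros N HN. tauto.
Qed.

Lemma appr_and a b : appr a -> appr b -> appr (fun N => a N /\ b N).
Proof.
  intros Ha Hb e He. destruct (Ha (e / 2)) as [m [c [Hc Hac]]]; [lra|].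
  destruct (Hb (e / 2)) as [n [d [Hd Hbd]]]; [lra|].
  exists (max m n), (fun N => c N /\ d N). split.
  - apply dep_and; [apply (dep_le m)|apply (dep_le n)]; auto; lia.
  - replace e with (e / 2 + e / 2) by field.
    eapply dens_lim_le_sub; [|apply dens_lim_le_or; [apply Hac|apply Hbd]].
    intros N HN. unfold symdiff in *.
    destruct (classic (a N <-> c N)); [right|left]; tauto.
Qed.

Lemma appr_fin a : fin a -> appr a.
Proof.
  intros H e He. exists 0%nat, (fun _ => False). split; [intros N N' _ []|].
  eapply dens_lim_le_sub; [|apply (dens_lim_le_fin a e); auto].
  unfold symdiff. intros N HN. tauto.
Qed.

Lemma appr_or a b : appr a -> appr b -> appr (fun N => a N \/ b N).
Proof.
  intros Ha Hb. replace (fun N => a N \/ b N) with (fun N => ~ (~ a N /\ ~ b N))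
    by (apply pred_ext; intros N; tauto).
  apply (appr_not (fun N => ~ a N /\ ~ b N)), appr_and; now apply appr_not.
Qed.

Lemma dens_symdiff a c n : Rabs (dens a n - dens c n) <= dens (symdiff a c) n.
Proof.
  assert (H : forall a c, dens a n <= dens c n + dens (symdiff a c) n).
  { intros a' c'. eapply Rle_trans; [|apply dens_or_le]. apply dens_le.
    intros N _ HN. unfold symdiff. tauto. }
  pose proof (H a c). pose proof (H c a).
  assert (dens (symdiff c a) n = dens (symdiff a c) n).
  { f_equal. apply pred_ext. unfold symdiff. intros; tauto. }
  apply Rabs_le. lra.
Qed.

(** The density of [a] eventually stays within [e / 3] of that of [c], which is constant from [m]
    on; so the sequence is Cauchy. *)
Lemma appr_cv a : appr a -> exists l, Un_cv (dens a) l.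
Proof.
  intros H. destruct (R_complete (dens a)) as [l Hl]; [|now exists l].
  intros e He. destruct (H (e / 3)) as [m [c [Hc [n0 Hn]]]]; [lra|].
  exists (max m n0). intros i j Hi Hj. unfold Rdist.
  pose proof (dens_symdiff a c i) as H1. pose proof (dens_symdiff a c j) as H2.
  rewrite (dens_dep m i c) in H1 by (auto; lia).
  rewrite (dens_dep m j c) in H2 by (auto; lia).
  pose proof (Hn i ltac:(lia)). pose proof (Hn j ltac:(lia)).
  unfold Rabs in H1, H2. destruct Rcase_abs in H1; destruct Rcase_abs in H2;
    apply Rabs_def1; lra.
Qed.

Definition mu (a : nat -> Prop) : R := epsilon (inhabits 0) (Un_cv (dens a)).

Lemma mu_cv a : appr a -> Un_cv (dens a) (mu a).
Proof. intros H. exact (epsilon_spec (inhabits 0) _ (appr_cv a H)). Qed.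

Lemma mu_eq a l : Un_cv (dens a) l -> mu a = l.
Proof.
  intros H. apply (UL_sequence (dens a)); auto.
  exact (epsilon_spec (inhabits 0) _ (ex_intro _ l H)).
Qed.

Lemma mu_mono a b : appr a -> appr b -> (forall N, a N -> b N) -> mu a <= mu b.
Proof.
  intros Ha Hb H. apply (Rle_cv_lim (Vn := dens b) (Un := dens a)).
  - intros n. apply dens_le. auto.
  - now apply mu_cv.
  - now apply mu_cv.
Qed.

Lemma mu_const_le a e : appr a -> dens_lim_le a e -> mu a <= e.
Proof.
  intros Ha [n0 Hn]. apply le_epsilon. intros d Hd.
  destruct (mu_cv a Ha d Hd) as [n1 H1].
  specialize (Hn (max n0 n1) ltac:(lia)). specialize (H1 (max n0 n1) ltac:(lia)).
  unfold Rdist in H1. apply Rabs_def2 in H1. lra.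
Qed.

Lemma mu_add a b : appr a -> appr b -> (forall N, a N -> b N -> False) ->
  mu (fun N => a N \/ b N) = mu a + mu b.
Proof.
  intros Ha Hb H. apply mu_eq.
  replace (dens (fun N => a N \/ b N)) with (fun n => dens a n + dens b n).
  - apply CV_plus; now apply mu_cv.
  - apply functional_extensionality. intros n. now rewrite dens_or_eq.
Qed.

Lemma mu_nonneg a : appr a -> 0 <= mu a.
Proof.
  intros Ha. apply (Rle_cv_lim (Vn := dens a) (Un := fun _ => 0)).
  - intros n. apply dens_nonneg.
  - intros e He. exists 0%nat. intros. rewrite R_dist_eq. auto.
  - now apply mu_cv.
Qed.

Lemma mu_or_le a b : appr a -> appr b -> mu (fun N => a N \/ b N) <= mu a + mu b.
Proof.
  intros Ha Hb.
  replace (fun N => a N \/ b N) with (fun N => a N \/ (b N /\ ~ a N)).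
  - rewrite mu_add; auto using appr_and, appr_not; try tauto.
    apply Rplus_le_compat_l, mu_mono; auto using appr_and, appr_not; tauto.
  - apply pred_ext. intros N. destruct (classic (a N)); tauto.
Qed.

Lemma mu_full : mu (fun _ => True) = 1.
Proof.
  apply mu_eq. intros e He. exists 0%nat. intros. rewrite dens_full, R_dist_eq. auto.
Qed.

Lemma mu_fin a : fin a -> mu a = 0.
Proof.
  intros H. pose proof (appr_fin a H). apply Rle_antisym.
  - apply le_epsilon. intros e He. rewrite Rplus_0_l.
    apply mu_const_le; auto. now apply dens_lim_le_fin.
  - now apply mu_nonneg.
Qed.

Lemma mu_null_sub a b : appr a -> appr b -> (forall N, a N -> b N) -> mu b = 0 -> mu a = 0.
Proof.
  intros Ha Hb H H0. apply Rle_antisym; [|now apply mu_nonneg].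
  rewrite <- H0. now apply mu_mono.
Qed.

Lemma mu_dep m c : dep m c -> mu c = dens c m.
Proof.
  intros H. apply mu_eq. intros e He. exists m. intros n Hn.
  rewrite (dens_dep m) by auto. rewrite R_dist_eq. auto.
Qed.

(** Reducing a member modulo [2 ^ m] gives a member below [2 ^ m], so a nonempty set has density at
    least [1 / 2 ^ m]. *)
Lemma dep_null m c : dep m c -> mu c = 0 -> forall N, ~ c N.
Proof.
  intros H H0 N HN. rewrite (mu_dep m) in H0 by auto.
  assert (c (N mod 2 ^ m)%nat) by (apply (H N); auto using agree_mod).
  assert (L : (N mod 2 ^ m < 2 ^ m)%nat) by (apply Nat.mod_upper_bound, Nat.pow_nonzero; lia).
  assert (P : forall n, (N mod 2 ^ m < n)%nat -> (0 < cnt c n)%nat).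
  { induction n as [|n IH]; simpl; [lia|]. intros Ln.
    destruct (excluded_middle_informative (c n)) as [h|h]; [lia|].
    assert (N mod 2 ^ m <> n)%nat by (intros E; apply h; now rewrite <- E).
    specialize (IH ltac:(lia)). lia. }
  specialize (P _ L). apply lt_0_INR in P.
  assert (0 < dens c m); [|lra].
  apply Rmult_lt_0_compat; auto. apply Rinv_0_lt_compat, pow2_pos.
Qed.

(** * Integers close to a small set of the Cantor space *)

Definition close_to (c : cantor -> Prop) (n : nat) : nat -> Prop :=
  fun N => exists y, c y /\ agree (bits N) y n.

Lemma close_to_dep c n : dep n (close_to c n).
Proof.
  intros N N' Ha [y [Hy H]]. exists y. split; auto.
  eapply agree_trans; [|apply H]. now apply agree_sym.
Qed.

Lemma close_to_anti c n m N : (n <= m)%nat -> close_to c m N -> close_to c n N.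
Proof. intros L [y [Hy H]]. exists y. split; auto. now apply (agree_le _ _ m). Qed.

Lemma nonprincipal_exists : exists u : (nat -> Prop) -> Prop,
  ultra u /\ forall n, u (fun k => (n <= k)%nat).
Proof.
  destruct (ultra_extend (fun a => exists n, a = (fun k => (n <= k)%nat))) as [u [Hu H]].
  - intros l Hl.
    assert (E : exists M, forall a, In a l -> forall k, (M <= k)%nat -> a k).
    { induction l as [|a l IH].
      - exists 0%nat. intros a [].
      - destruct IH as [M HM]. { intros b Hb. apply Hl. now right. }
        destruct (Hl a (or_introl eq_refl)) as [n ->].
        exists (max n M). intros b [<-|Hb] k Hk; [lia|]. apply (HM b Hb). lia. }
    destruct E as [M HM]. exists M. intros a Ha. now apply (HM a Ha).
  - exists u. split; auto. intros n. apply H. now exists n.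
Qed.

(* Compactness of the Cantor space: a sequence of counterexamples has a limit along a
   nonprincipal ultrafilter, which lies in the closure of [c] but in none of the cylinders. *)
Lemma close_to_finite_cover c (s : nat -> list bool) :
  (forall x, cl c x -> exists k, in_cyl (s k) x) ->
  exists n, forall N, close_to c n N ->
    exists i, (i <= n)%nat /\ (length (s i) <= n)%nat /\ in_cyl (s i) (bits N).
Proof.
  intros H. apply NNPP. intros Hn.
  assert (Hch : forall n, exists N, close_to c n N /\
    ~ exists i, (i <= n)%nat /\ (length (s i) <= n)%nat /\ in_cyl (s i) (bits N)).
  { intros n. apply NNPP. intros Nn. apply Hn. exists n. intros N HN.
    apply NNPP. intros Ni. apply Nn. now exists N. }
  apply choice in Hch. destruct Hch as [b Hb].
  destruct nonprincipal_exists as [u [Hu Hge]].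
  set (x := fun i => if excluded_middle_informative (u (fun n => bits (b n) i = true))
    then true else false).
  assert (Hx : forall i, u (fun n => bits (b n) i = x i)).
  { intros i. unfold x. destruct excluded_middle_informative as [h|h]; auto.
    destruct (ultra_em u Hu (fun n => bits (b n) i = true)) as [|h']; [contradiction|].
    apply (ultra_up u Hu _ _ (fun n => proj1 (Bool.not_true_iff_false _)) h'). }
  assert (Hxn : forall n, u (fun k => agree (bits (b k)) x n)).
  { induction n as [|n IH].
    - apply (ultra_up u Hu (fun k => (0 <= k)%nat)); auto. intros k _ i Hi. lia.
    - refine (ultra_up u Hu _ _ _ (ultra_and u Hu _ _ IH (Hx n))).
      intros k [h1 h2] i Hi. destruct (Nat.eq_dec i n) as [->|]; [exact h2|].
      apply h1. lia. }
  assert (Hcl : cl c x).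
  { intros n.
    destruct (ultra_ex u Hu _ (ultra_and u Hu _ _ (Hxn n) (Hge n))) as [k [H1 H2]].
    destruct (proj1 (Hb k)) as [y [Hy Hay]]. exists y. split; auto.
    eapply agree_trans; [apply agree_sym, H1|]. now apply (agree_le _ _ k). }
  destruct (H x Hcl) as [i Hi].
  destruct (ultra_ex u Hu _ (ultra_and u Hu _ _ (Hxn (length (s i)))
    (Hge (max i (length (s i)))))) as [k [H1 H2]].
  apply (proj2 (Hb k)). exists i. split; [lia|split; [lia|]].
  intros j Hj. rewrite (H1 j Hj). now apply Hi.
Qed.

Lemma cnt_le_one a n : (forall N N', (N < n)%nat -> (N' < n)%nat -> a N -> a N' -> N = N') ->
  (cnt a n <= 1)%nat.
Proof.
  induction n as [|n IH]; simpl; intros H; auto.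
  destruct (excluded_middle_informative (a n)) as [h|h].
  - replace (cnt a n) with (cnt (fun _ => False) n).
    + clear. induction n as [|n IH]; simpl; auto.
      destruct (excluded_middle_informative False); [tauto|lia].
    + apply cnt_ext. intros N HN. split; [tauto|]. intros HN'.
      specialize (H N n ltac:(lia) ltac:(lia) HN' h). lia.
  - assert (cnt a n <= 1)%nat; [|lia]. apply IH. intros N N' H1 H2. apply H; lia.
Qed.

Lemma in_cyl_dep s : dep (length s) (fun N => in_cyl s (bits N)).
Proof. intros N N' Ha H i Hi. rewrite <- (Ha i Hi). now apply H. Qed.

Lemma in_cyl_dens s n : (length s <= n)%nat ->
  dens (fun N => in_cyl s (bits N)) n <= (/ 2) ^ length s.
Proof.
  intros L. rewrite (dens_dep (length s)) by (auto using in_cyl_dep).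
  unfold dens. rewrite pow_inv. unfold Rdiv.
  rewrite <- (Rmult_1_l (/ 2 ^ length s)) at 2.
  apply Rmult_le_compat_r; [apply Rlt_le, Rinv_0_lt_compat, pow2_pos|].
  replace 1 with (INR 1) by reflexivity. apply le_INR. apply cnt_le_one.
  intros N N' H H' Ha Ha'. apply (agree_lt_eq N N' (length s)); auto.
  intros i Hi. rewrite <- (Ha i Hi). now apply Ha'.
Qed.

(** Since it is the closure of [c] that is null, compactness applies to a cover by cylinders of
    total weight at most [e]: finitely many of them already contain a neighbourhood of [c]. *)
Lemma close_to_small c : in_E c -> forall e, 0 < e ->
  exists n0, forall n, (n0 <= n)%nat -> dens (close_to c n) n <= e.
Proof.
  intros HE e He. destruct (HE e He) as [s [Hs Hsum]].
  destruct (close_to_finite_cover c s Hs) as [n0 Hn0].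
  exists n0. intros n L.
  apply Rle_trans with (dens (close_to c n0) n).
  { apply dens_le. intros N _. now apply close_to_anti. }
  (* Only cylinders of length at most [n0], hence at most [n], are counted, so each has reached its
     final density at scale [n]. *)
  assert (Hm : forall m, dens (fun N => exists i, (i <= m)%nat /\ (length (s i) <= n0)%nat /\
    in_cyl (s i) (bits N)) n <= sum_f_R0 (fun k => (/ 2) ^ length (s k)) m).
  { assert (H1 : forall i, dens (fun N => (length (s i) <= n0)%nat /\
      in_cyl (s i) (bits N)) n <= (/ 2) ^ length (s i)).
    { intros i. destruct (Nat.le_gt_cases (length (s i)) n0) as [Li|Li].
      - eapply Rle_trans; [|apply (in_cyl_dens (s i) n); lia]. apply dens_le. now intros N _ [].
      - eapply Rle_trans; [apply (dens_le _ (fun _ => False))|].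
        + intros N _ []. lia.
        + rewrite (dens_dep 0 n (fun _ => False)); [|intros ? ? ? []|lia].
          unfold dens. simpl. destruct excluded_middle_informative; [tauto|].
          simpl. assert (0 < (/ 2) ^ length (s i)) by (apply pow_lt; lra). lra. }
    induction m as [|m IH]; simpl.
    - eapply Rle_trans; [|apply (H1 0%nat)]. apply dens_le.
      intros N _ [i [Hi H]]. now replace i with 0%nat in H by lia.
    - eapply Rle_trans; [|apply Rplus_le_compat; [apply IH|apply H1]].
      eapply Rle_trans; [|apply dens_or_le]. apply dens_le.
      intros N _ [i [Hi H]]. destruct (Nat.eq_dec i (S m)) as [->|]; [now right|left].
      exists i. split; auto. lia. }
  eapply Rle_trans; [|apply (Hsum n0)]. eapply Rle_trans; [|apply Hm].
  apply dens_le. intros N _. apply Hn0.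
Qed.

(** * The algebra generated by a family together with digit sets and singletons *)

Inductive gen (S : (nat -> Prop) -> Prop) : (nat -> Prop) -> Prop :=
  | gen_base a : S a -> gen S a
  | gen_bit i : gen S (fun N => bits N i = true)
  | gen_sing n : gen S (fun N => N = n)
  | gen_not a : gen S a -> gen S (fun N => ~ a N)
  | gen_and a b : gen S a -> gen S b -> gen S (fun N => a N /\ b N).

Lemma gen_or S a b : gen S a -> gen S b -> gen S (fun N => a N \/ b N).
Proof.
  intros Ha Hb. replace (fun N => a N \/ b N) with (fun N => ~ (~ a N /\ ~ b N))
    by (apply pred_ext; intros N; tauto).
  apply (gen_not S (fun N => ~ a N /\ ~ b N)), gen_and; now apply gen_not.
Qed.

Lemma gen_false S : gen S (fun _ => False).
Proof.
  replace (fun _ : nat => False) with (fun N : nat => N = 0%nat /\ ~ N = 0%nat)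
    by (apply pred_ext; tauto).
  apply gen_and; [apply gen_sing|]. apply (gen_not S (fun N => N = 0%nat)), gen_sing.
Qed.

Lemma gen_true S : gen S (fun _ => True).
Proof.
  replace (fun _ : nat => True) with (fun _ : nat => ~ False) by (apply pred_ext; tauto).
  apply (gen_not S (fun _ => False)), gen_false.
Qed.

Lemma gen_diff S a b : gen S a -> gen S b -> gen S (fun N => a N /\ ~ b N).
Proof. intros Ha Hb. apply gen_and; auto. now apply gen_not. Qed.

Lemma gen_mono (S S' : (nat -> Prop) -> Prop) a :
  (forall b, S b -> S' b) -> gen S a -> gen S' a.
Proof. intros H. induction 1; eauto using gen. Qed.

Lemma gen_dep S m : forall c, dep m c -> gen S c.
Proof.
  induction m as [|m IH]; intros c Hc.
  - destruct (classic (c 0%nat)) as [h|h].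
    + replace c with (fun _ : nat => True); [apply gen_true|].
      apply pred_ext. intros N. split; auto. intros _. apply (Hc 0%nat); auto.
      intros i Hi. lia.
    + replace c with (fun _ : nat => False); [apply gen_false|].
      apply pred_ext. intros N. split; [tauto|]. intros HN. apply h, (Hc N); auto.
      intros i Hi. lia.
  (* [d b] prescribes the value [b] for digit [m] and then forgets that digit, so it depends on the
     first [m] digits alone. *)
  - set (d := fun b N => exists N', agree (bits N) (bits N') m /\ bits N' m = b /\ c N').
    assert (Hd : forall b, gen S (d b)).
    { intros b. apply IH. intros N N' Ha [M [H1 H2]]. exists M. split; auto.
      eapply agree_trans; [|apply H1]. now apply agree_sym. }
    assert (Hdc : forall b N, bits N m = b -> (c N <-> d b N)).
    { intros b N HN. split.
      - intros h. exists N. split; [|split]; auto. intros i Hi. auto.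
      - intros [N' [H1 [H2 H3]]]. apply (Hc N'); auto. intros i Hi.
        destruct (Nat.eq_dec i m) as [->|]; [congruence|]. symmetry. apply H1. lia. }
    replace c with (fun N => bits N m = true /\ d true N \/ ~ bits N m = true /\ d false N).
    + apply gen_or; apply gen_and; auto; [|apply (gen_not S (fun N => bits N m = true))];
        apply gen_bit.
    + apply pred_ext. intros N. destruct (bits N m) eqn:E.
      * rewrite (Hdc true N E). intuition congruence.
      * rewrite (Hdc false N E). intuition congruence.
Qed.

Lemma gen_fin S a : fin a -> gen S a.
Proof.
  intros [B H]. revert a H. induction B as [|B IH]; intros a H.
  - replace a with (fun _ : nat => False); [apply gen_false|].
    apply pred_ext. intros N. split; [tauto|]. intros HN. specialize (H N HN). lia.
  - assert (Ha : gen S (fun N => a N /\ N <> B)).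
    { apply IH. intros N [HN HB]. specialize (H N HN). lia. }
    destruct (classic (a B)) as [h|h].
    + replace a with (fun N => (a N /\ N <> B) \/ N = B).
      * apply gen_or; auto. apply gen_sing.
      * apply pred_ext. intros N. destruct (Nat.eq_dec N B) as [->|]; tauto.
    + replace a with (fun N => a N /\ N <> B); auto.
      apply pred_ext. intros N. destruct (Nat.eq_dec N B) as [->|]; tauto.
Qed.

Lemma gen_appr S a : (forall b, S b -> appr b) -> gen S a -> appr a.
Proof.
  intros H. induction 1 as [a Ha|i|n|a Ha IH|a b Ha IH Hb IH'].
  - auto.
  - apply (appr_dep (Datatypes.S i)). intros N N' Hag HN. rewrite <- HN. symmetry. apply Hag. lia.
  - apply appr_fin. exists (Datatypes.S n). intros N ->. lia.
  - now apply appr_not.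
  - now apply appr_and.
Qed.

(** * Families dominated by one function, standing in for families of fewer than b sets *)

Definition bounded_on (Q : (nat -> Prop) -> Prop) : Prop :=
  forall g : (nat -> Prop) -> nat -> nat,
    exists G, forall a, Q a -> exists m, forall n, (m <= n)%nat -> (g a n <= G n)%nat.

Lemma bounded_on_sub (P Q : (nat -> Prop) -> Prop) :
  (forall a, P a -> Q a) -> bounded_on Q -> bounded_on P.
Proof. intros H HQ g. destruct (HQ g) as [G HG]. exists G. auto. Qed.

Lemma bounded_on_image (P : (nat -> Prop) -> Prop) f :
  bounded_on P -> bounded_on (fun b => exists a, P a /\ b = f a).
Proof.
  intros H g. destruct (H (fun a => g (f a))) as [G HG]. exists G.
  intros b [a [Ha ->]]. auto.
Qed.

(** Domination is used twice: for fixed [a] over all [b], which yields a function [h a], and then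
    for these functions over all [a]. *)
Lemma bounded_on_image2 (P : (nat -> Prop) -> Prop) f :
  bounded_on P -> bounded_on (fun c => exists a b, P a /\ P b /\ c = f a b).
Proof.
  intros H g.
  assert (Hch : forall a, exists G, forall b, P b ->
    exists m, forall n, (m <= n)%nat -> (g (f a b) n <= G n)%nat).
  { intros a. apply (H (fun b => g (f a b))). }
  apply choice in Hch. destruct Hch as [h Hh].
  destruct (H h) as [G HG]. exists G. intros c [a [b [Ha [Hb ->]]]].
  destruct (Hh a b Hb) as [m Hm], (HG a Ha) as [m' Hm'].
  exists (max m m'). intros n Hn. specialize (Hm n ltac:(lia)). specialize (Hm' n ltac:(lia)). lia.
Qed.

Fixpoint max_upto (h : nat -> nat) (n : nat) : nat :=
  match n with O => h O | S n => max (max_upto h n) (h (S n)) end.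

Lemma max_upto_ge h n k : (k <= n)%nat -> (h k <= max_upto h n)%nat.
Proof.
  induction n as [|n IH]; simpl; intros L.
  - now replace k with 0%nat by lia.
  - destruct (Nat.eq_dec k (S n)) as [->|]; [lia|]. specialize (IH ltac:(lia)). lia.
Qed.

(** The countably many bounds [h k] are dominated by a running maximum, which includes [h k n] as
    soon as [n] reaches [k]. *)
Lemma bounded_on_ex (Q : nat -> (nat -> Prop) -> Prop) :
  (forall k, bounded_on (Q k)) -> bounded_on (fun a => exists k, Q k a).
Proof.
  intros H g.
  assert (Hch : forall k, exists G, forall a, Q k a ->
    exists m, forall n, (m <= n)%nat -> (g a n <= G n)%nat).
  { intros k. apply (H k g). }
  apply choice in Hch. destruct Hch as [h Hh].
  exists (fun n => max_upto (fun k => h k n) n). intros a [k Hk].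
  destruct (Hh k a Hk) as [m Hm]. exists (max m k). intros n Hn.
  specialize (Hm n ltac:(lia)). pose proof (max_upto_ge (fun k => h k n) n k ltac:(lia)).
  simpl in *. lia.
Qed.

Lemma bounded_on_sing b : bounded_on (fun a => a = b).
Proof. intros g. exists (g b). intros a ->. exists 0%nat. auto. Qed.

Lemma bounded_on_or P Q : bounded_on P -> bounded_on Q -> bounded_on (fun a => P a \/ Q a).
Proof.
  intros HP HQ.
  apply (bounded_on_sub _ (fun a => exists k, match k with O => P a | _ => Q a end)).
  - intros a [h|h]; [now exists 0%nat|now exists 1%nat].
  - apply (bounded_on_ex (fun k a => match k with O => P a | _ => Q a end)).
    intros [|k]; auto.
Qed.

(** Cutting the generated algebra into countably many levels reduces its domination to images and
    countable unions. *)
Fixpoint stage (S : (nat -> Prop) -> Prop) (k : nat) : (nat -> Prop) -> Prop :=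
  match k with
  | O => fun a => (S a \/ exists i, a = (fun N => bits N i = true)) \/ exists n, a = (fun N => N = n)
  | Datatypes.S k => fun a => (stage S k a \/ exists b, stage S k b /\ a = (fun N => ~ b N)) \/
      exists b c, stage S k b /\ stage S k c /\ a = (fun N => b N /\ c N)
  end.

Lemma stage_le S k l a : (k <= l)%nat -> stage S k a -> stage S l a.
Proof. induction 1; auto. simpl. auto. Qed.

Lemma gen_stage S a : gen S a -> exists k, stage S k a.
Proof.
  induction 1 as [a Ha|i|n|a Ha [k IH]|a b Ha [k IH] Hb [l IH']].
  - exists 0%nat. simpl. auto.
  - exists 0%nat. simpl. eauto.
  - exists 0%nat. simpl. eauto.
  - exists (Datatypes.S k). simpl. eauto.
  - exists (Datatypes.S (max k l)). simpl. right. exists a, b. split; [|split]; auto.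
    + apply (stage_le S k); auto. lia.
    + apply (stage_le S l); auto. lia.
Qed.

Lemma bounded_on_gen S : bounded_on S -> bounded_on (gen S).
Proof.
  intros H. apply (bounded_on_sub _ (fun a => exists k, stage S k a)); [apply gen_stage|].
  apply bounded_on_ex. induction k as [|k IH]; simpl.
  - apply bounded_on_or; [apply bounded_on_or|]; auto;
      apply (bounded_on_ex (fun i a => a = _)); intros; apply bounded_on_sing.
  - apply bounded_on_or; [apply bounded_on_or|]; auto.
    + now apply (bounded_on_image _ (fun b N => ~ b N)).
    + now apply (bounded_on_image2 _ (fun b c N => b N /\ c N)).
Qed.

(** * Adjoining one set *)

(** Dropping the integers below [2 ^ n] makes the density bound valid at every scale and not merely
    from [n] on, and it leaves only finitely many of the sets [close_tail (C k) (f k)] with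
    [k <= f k] that meet a given interval. *)
Definition close_tail (c : cantor -> Prop) (n : nat) : nat -> Prop :=
  fun N => (2 ^ n <= N)%nat /\ close_to c n N.

Lemma close_tail_anti c n m N : (n <= m)%nat -> close_tail c m N -> close_tail c n N.
Proof.
  intros L [H1 H2]. split; [|now apply (close_to_anti c n m)].
  eapply Nat.le_trans; [|apply H1]. apply Nat.pow_le_mono_r; lia.
Qed.

Lemma close_tail_gen S c n : gen S (close_tail c n).
Proof.
  apply (gen_and S (fun N => (2 ^ n <= N)%nat)); [|apply (gen_dep S n), close_to_dep].
  replace (fun N => (2 ^ n <= N)%nat) with (fun N => ~ (N < 2 ^ n)%nat).
  - apply (gen_not S (fun N => (N < 2 ^ n)%nat)), gen_fin. exists (2 ^ n)%nat. auto.
  - apply pred_ext. intros N. lia.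
Qed.

Lemma dens_close_tail_le c n k : dens (close_tail c n) k <= dens (close_to c n) n.
Proof.
  destruct (Nat.le_gt_cases n k) as [L|L].
  - rewrite <- (dens_dep n k (close_to c n)) by auto using close_to_dep. apply dens_le. now intros N _ [].
  - eapply Rle_trans; [apply (dens_le _ (fun _ => False))|].
    + intros N HN [H _]. assert (2 ^ k <= 2 ^ n)%nat by (apply Nat.pow_le_mono_r; lia). lia.
    + rewrite (dens_dep 0 k (fun _ => False)); [|intros ? ? ? []|lia].
      unfold dens at 1. simpl. destruct excluded_middle_informative; [tauto|].
      simpl. pose proof (dens_nonneg (close_to c n) n). lra.
Qed.

Definition tail (C : nat -> cantor -> Prop) (f : nat -> nat) (K : nat) : nat -> Prop :=
  fun N => exists k, (K <= k)%nat /\ close_tail (C k) (f k) N.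

(** Density is not countably subadditive in general. Here each interval [[0, 2^n)] meets only
    finitely many of the sets, and their bounds [d / 2 ^ (k + 2)] form a geometric series. *)
Lemma dens_tail C f K d : 0 <= d ->
  (forall k, (k <= f k)%nat) ->
  (forall k, (K <= k)%nat -> dens (close_to (C k) (f k)) (f k) <= d / 2 ^ (k + 2)) ->
  forall n, dens (tail C f K) n <= d / 2 ^ (K + 1).
Proof.
  intros Hd Hf HV n.
  assert (H : forall p, dens (fun N => exists k, (K <= k < K + p)%nat /\ close_tail (C k) (f k) N) n
    <= d / 2 ^ (K + 1) - d / 2 ^ (K + p + 1)).
  { induction p as [|p IH].
    - eapply Rle_trans; [apply (dens_le _ (fun _ => False))|].
      + intros N _ [k [Hk _]]. lia.
      + rewrite (dens_dep 0 n (fun _ => False)); [|intros ? ? ? []|lia].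
        unfold dens at 1. simpl. destruct excluded_middle_informative; [tauto|].
        rewrite Nat.add_0_r. simpl. lra.
    - apply Rle_trans with (d / 2 ^ (K + 1) - d / 2 ^ (K + p + 1) + d / 2 ^ (K + p + 2)).
      + eapply Rle_trans; [|apply Rplus_le_compat;
          [apply IH|apply (HV (K + p)%nat); lia]].
        eapply Rle_trans; [|apply Rplus_le_compat_l, dens_close_tail_le].
        eapply Rle_trans; [|apply dens_or_le]. apply dens_le.
        intros N _ [k [Hk H]]. destruct (Nat.eq_dec k (K + p)) as [->|]; [now right|left].
        exists k. split; auto. lia.
      + replace (K + S p + 1)%nat with (S (K + p + 1)) by lia.
        replace (K + p + 2)%nat with (S (K + p + 1)) by lia. simpl.
        apply Req_le. field. split; apply Rgt_not_eq, pow2_pos. }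
  (* A member of the [k]-th set below [2 ^ n] is at least [2 ^ f k], whence [k <= f k < n]; so [n]
     terms from [K] on suffice. *)
  apply Rle_trans with (d / 2 ^ (K + 1) - d / 2 ^ (K + n + 1)).
  - eapply Rle_trans; [|apply (H n)]. apply dens_le.
    intros N HN [k [Hk Hw]]. exists k. split; auto. split; auto.
    destruct Hw as [Hw _].
    assert (2 ^ f k < 2 ^ n)%nat by lia.
    apply Nat.pow_lt_mono_r_iff in H0; [|lia]. specialize (Hf k). lia.
  - assert (0 <= d / 2 ^ (K + n + 1)); [|lra].
    apply Rmult_le_pos; auto. apply Rlt_le, Rinv_0_lt_compat, pow2_pos.
Qed.

(** * Finite sequences of choices, coded by integers *)

Fixpoint code (s : list nat) : nat :=
  match s with nil => O | x :: s => S (Cantor.to_nat (x, code s)) end.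

Lemma code_inj s t : code s = code t -> s = t.
Proof.
  revert t. induction s as [|x s IH]; intros [|y t] H; try discriminate; auto.
  apply Nat.succ_inj in H. apply Cantor.to_nat_inj in H. injection H as -> H.
  f_equal. auto.
Qed.

(** Turns a bound valid at all large codes into one valid at all large indices of the
    construction. *)
Lemma length_le_code s : (length s <= code s)%nat.
Proof.
  induction s as [|x s IH]; [apply Nat.le_0_l|].
  pose proof (Cantor.to_nat_non_decreasing x (code s)).
  change (S (length s) <= S (Cantor.to_nat (x, code s)))%nat. lia.
Qed.

(* The choices made so far are listed latest first, so that [n :: s] chooses [n] at
   index [length s]. *)
Fixpoint close_tails (C : nat -> cantor -> Prop) (s : list nat) : nat -> Prop :=
  match s with
  | nil => fun _ => False
  | n :: s => fun N => close_tails C s N \/ close_tail (C (length s)) n N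
  end.

Lemma close_tails_gen S C s : gen S (close_tails C s).
Proof.
  induction s as [|n s IH]; simpl; [apply gen_false|]. apply gen_or; auto. apply close_tail_gen.
Qed.

Fixpoint history (F : list nat -> nat) (k : nat) : list nat :=
  match k with O => nil | S k => F (history F k) :: history F k end.

Lemma length_history F k : length (history F k) = k.
Proof. induction k; simpl; auto. Qed.

Lemma close_tails_history C F k N : close_tails C (history F k) N <->
  exists l, (l < k)%nat /\ close_tail (C l) (F (history F l)) N.
Proof.
  induction k as [|k IH]; simpl.
  - split; [tauto|]. intros [l [Hl _]]. lia.
  - rewrite IH, length_history. split.
    + intros [[l [Hl H]]|H]; [exists l|exists k]; auto.
    + intros [l [Hl H]]. destruct (Nat.eq_dec l k) as [->|]; [now right|left].
      exists l. split; auto. lia.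
Qed.

(* The two clauses keep [a] intersected with the new set, resp. [a] minus the new set, from
   being infinite of density zero. *)
Definition good_choice (C : nat -> cantor -> Prop) (a : nat -> Prop) (s : list nat) (n : nat)
  : Prop :=
  ((exists m, forall N, a N -> ~ close_tail (C (length s)) m N) ->
     forall N, a N -> ~ close_tail (C (length s)) n N) /\
  (0 < mu (fun N => a N /\ ~ close_tails C s N) ->
     dens (close_to (C (length s)) n) n <= mu (fun N => a N /\ ~ close_tails C s N) / 2 ^ (length s + 2)).

(** The first clause persists because tails shrink as [n] grows, the second because neighbourhoods
    of a set in the ideal have density tending to zero. *)
Lemma good_choice_eventually C a s : (forall k, in_E (C k)) ->
  exists n0, forall n, (n0 <= n)%nat -> good_choice C a s n.
Proof.
  intros HC.
  assert (H1 : exists n1, forall n, (n1 <= n)%nat ->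
    (exists m, forall N, a N -> ~ close_tail (C (length s)) m N) ->
    forall N, a N -> ~ close_tail (C (length s)) n N).
  { destruct (classic (exists m, forall N, a N -> ~ close_tail (C (length s)) m N)) as [[m Hm]|H].
    - exists m. intros n L _ N HN Hw. apply (Hm N HN). now apply (close_tail_anti _ m n).
    - exists 0%nat. intros n _ H'. contradiction. }
  destruct H1 as [n1 H1].
  assert (H2 : exists n2, forall n, (n2 <= n)%nat ->
    0 < mu (fun N => a N /\ ~ close_tails C s N) ->
    dens (close_to (C (length s)) n) n <= mu (fun N => a N /\ ~ close_tails C s N) / 2 ^ (length s + 2)).
  { destruct (Rlt_dec 0 (mu (fun N => a N /\ ~ close_tails C s N))) as [h|h].
    - destruct (close_to_small (C (length s)) (HC _)
        (mu (fun N => a N /\ ~ close_tails C s N) / 2 ^ (length s + 2))) as [n2 Hn2].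
      + apply Rmult_lt_0_compat; auto. apply Rinv_0_lt_compat, pow2_pos.
      + exists n2. intros n L _. auto.
    - exists 0%nat. intros n _ H'. contradiction. }
  destruct H2 as [n2 H2].
  exists (max n1 n2). intros n L. split; [apply H1|apply H2]; lia.
Qed.

(** A single step of the recursion. The two implications about [a] are what is needed for the
    algebra enlarged by [Y] to have no infinite null set. *)
Lemma extension_step (S : (nat -> Prop) -> Prop) (C : nat -> cantor -> Prop) :
  (forall a, S a -> appr a) -> (forall a, gen S a -> mu a = 0 -> fin a) -> bounded_on S ->
  (forall k, in_E (C k)) ->
  exists Y f, appr Y /\ mu Y <= / 2 /\ (forall k N, close_tail (C k) (f k) N -> Y N) /\
    forall a, gen S a -> (mu (fun N => a N /\ Y N) = 0 -> fin (fun N => a N /\ Y N)) /\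
      (mu (fun N => a N /\ ~ Y N) = 0 -> fin (fun N => a N /\ ~ Y N)).
Proof.
  intros HS HP HB HC.
  (* What is a good choice at an index depends on the earlier choices. Passing to their code makes
     the threshold demanded by each set [a] a function of one integer, to which domination applies;
     0 is the default for an integer that is no code. *)
  assert (Hch : forall p : (nat -> Prop) * nat, exists n0, forall s n, code s = snd p ->
    (n0 <= n)%nat -> good_choice C (fst p) s n).
  { intros [a M]. simpl. destruct (classic (exists s, code s = M)) as [[s Hs]|H].
    - destruct (good_choice_eventually C a s HC) as [n0 Hn0]. exists n0.
      intros s' n E L. replace s' with s by (apply code_inj; congruence). auto.
    - exists 0%nat. intros s n E. exfalso. eauto. }
  apply choice in Hch. destruct Hch as [g Hg].
  destruct (bounded_on_gen S HB (fun a M => g (a, M))) as [G HG].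
  assert (Hv : forall k, exists n0, forall n, (n0 <= n)%nat ->
    dens (close_to (C k) n) n <= 1 / 2 ^ (k + 2)).
  { intros k. apply close_to_small; auto. apply Rmult_lt_0_compat; [lra|].
    apply Rinv_0_lt_compat, pow2_pos. }
  apply choice in Hv. destruct Hv as [v Hv].
  (* [G] meets the demands of each old set at almost all indices, [length s] ensures [k <= f k], and
     [v] keeps the whole union of measure at most one half. *)
  set (F := fun s : list nat => max (G (code s)) (max (length s) (v (length s)))).
  set (f := fun k => F (history F k)).
  assert (Hfk : forall k, (k <= f k)%nat).
  { intros k. unfold f, F. rewrite length_history. lia. }
  assert (Hfv : forall k, dens (close_to (C k) (f k)) (f k) <= 1 / 2 ^ (k + 2)).
  { intros k. apply Hv. unfold f, F. rewrite length_history. lia. }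
  assert (Hfa : forall a, gen S a -> exists K, forall k, (K <= k)%nat ->
    good_choice C a (history F k) (f k)).
  { intros a Ha. destruct (HG a Ha) as [m Hm]. exists m. intros k L.
    apply (Hg (a, code (history F k))); auto. simpl.
    assert (m <= code (history F k))%nat.
    { pose proof (length_le_code (history F k)). rewrite length_history in *. lia. }
    exact (Nat.le_trans _ _ _ (Hm _ H) (Nat.le_max_l _ _)). }
  set (Y := fun N => exists k, close_tail (C k) (f k) N).
  assert (Ht : forall K n, dens (tail C f K) n <= 1 / 2 ^ (K + 1)).
  { intros K n. apply (dens_tail C f K 1); [lra|apply Hfk|intros; apply Hfv]. }
  (* Finite unions of tails belong to the old algebra, and they miss only part of [tail C f K],
     whose density is at most [1 / 2 ^ (K + 1)] at every scale. *)
  assert (HY : appr Y).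
  { apply appr_limit. intros e He. destruct (pow2_unbounded (1 / e)) as [K HK].
    exists (close_tails C (history F K)). split.
    - apply (gen_appr S); auto. apply close_tails_gen.
    - apply dens_lim_le_sub with (b := tail C f K).
      + intros N HN. unfold symdiff in HN. rewrite close_tails_history in HN.
        apply NNPP. intros Nt. apply HN. split.
        * intros [k Hk]. exists k. split; auto. apply Nat.nle_gt. intros L.
          apply Nt. now exists k.
        * intros [l [_ Hl]]. now exists l.
      + exists 0%nat. intros n _. eapply Rle_trans; [apply Ht|].
        specialize (HK (K + 1)%nat ltac:(lia)).
        apply (Rmult_lt_compat_r e) in HK; auto. unfold Rdiv in HK.
        rewrite Rmult_assoc, Rinv_l, Rmult_1_r in HK by lra.
        pose proof (pow2_pos (K + 1)).
        apply (Rmult_le_reg_r (2 ^ (K + 1))); auto. unfold Rdiv.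
        rewrite Rmult_assoc, Rinv_l by lra. lra. }
  exists Y, f. split; [exact HY|split; [|split]].
  - apply mu_const_le; auto. exists 0%nat. intros n _.
    eapply Rle_trans; [|eapply Rle_trans; [apply (Ht 0%nat n)|simpl; lra]].
    apply dens_le. intros N _ [k Hk]. exists k. split; auto. lia.
  - intros k N H. now exists k.
  - intros a Ha. pose proof (gen_appr S a HS Ha) as Aa.
    destruct (Hfa a Ha) as [K HK]. split.
    + intros H0.
      (* The part of [a] in a single tail is a null member of the old algebra, hence finite. So a
         smaller tail is disjoint from [a], and for [k] beyond [K] the first clause of [good_choice]
         makes the chosen one disjoint too; finitely many finite sets remain. *)
      assert (Hfin : forall k, fin (fun N => a N /\ close_tail (C k) (f k) N)).
      { intros k. assert (HW := close_tail_gen S (C k) (f k)). apply HP.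
        - now apply gen_and.
        - apply (mu_null_sub _ (fun N => a N /\ Y N)); auto using appr_and.
          + apply appr_and; auto. now apply (gen_appr S).
          + intros N [h1 h2]. split; auto. now exists k. }
      assert (Hemp : forall k, (K <= k)%nat -> forall N, a N -> ~ close_tail (C k) (f k) N).
      { intros k L. destruct (HK k L) as [H1 _]. rewrite length_history in H1.
        apply H1. destruct (Hfin k) as [B HB'].
        (* Members of this smaller tail are at least 2 to the power [max B (f k)], hence beyond the
           bound [B] of the finite intersection. *)
        exists (max B (f k)). intros N HN Hw.
        assert (N < B)%nat.
        { apply HB'. split; auto. apply (close_tail_anti _ _ (max B (f k))); auto. lia. }
        destruct Hw as [Hw _].
        assert (max B (f k) < 2 ^ max B (f k))%nat by (apply Nat.pow_gt_lin_r; lia). lia. }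
      apply (fin_sub _ (fun N => exists k, (k < K)%nat /\ a N /\ close_tail (C k) (f k) N)).
      * intros N [HN [k Hk]]. exists k. split; auto. apply Nat.nle_gt. intros L.
        now apply (Hemp k L N).
      * clear - Hfin. induction K as [|K IH].
        -- exists 0%nat. intros N [k [Hk _]]. lia.
        -- eapply fin_sub; [|apply (fin_or _ _ IH (Hfin K))].
           intros N [k [Hk H]]. destruct (Nat.eq_dec k K) as [->|]; [now right|left].
           exists k. split; auto. lia.
    + intros H0.
      (* [r k] measures what the first [k] tails leave of [a]. If some [r k] vanishes, that residue
         is a null member of the old algebra, so it is finite and contains [a] minus [Y]. *)
      set (r := fun k => mu (fun N => a N /\ ~ close_tails C (history F k) N)).
      assert (Hr : forall k, gen S (fun N => a N /\ ~ close_tails C (history F k) N)).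
      { intros k. apply gen_diff; auto. apply close_tails_gen. }
      destruct (classic (exists k, r k = 0)) as [[k Hk]|Hnz].
      { apply (fin_sub _ (fun N => a N /\ ~ close_tails C (history F k) N)).
        - intros N [h1 h2]. split; auto. rewrite close_tails_history. intros [l [_ Hl]].
          apply h2. now exists l.
        - apply HP; auto. }
      exfalso.
      assert (Hpos : forall k, 0 < r k).
      { intros k. destruct (mu_nonneg _ (gen_appr S _ HS (Hr k))) as [h|h]; auto.
        exfalso. apply Hnz. exists k. unfold r. auto. }
      (* By the second clause of [good_choice] the bound at [k] is [r k / 2 ^ (k + 2)], and
         [r k <= r K] because residues decrease. *)
      assert (HtK : forall n, dens (tail C f K) n <= r K / 2 ^ (K + 1)).
      { apply dens_tail; auto; [specialize (Hpos K); lra|].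
        intros k L. destruct (HK k L) as [_ H2]. rewrite length_history in H2.
        eapply Rle_trans; [apply H2, Hpos|].
        apply Rmult_le_compat_r; [apply Rlt_le, Rinv_0_lt_compat, pow2_pos|].
        apply mu_mono; try (apply (gen_appr S); auto).
        intros N [h1 h2]. split; auto. rewrite close_tails_history in *.
        intros [l [Hl Hl']]. apply h2. exists l. split; auto. lia. }
      assert (Hle : r K <= mu (fun N => a N /\ ~ Y N) + r K / 2 ^ (K + 1)).
      { assert (Ad : appr (fun N => a N /\ ~ close_tails C (history F K) N)) by
          (apply (gen_appr S); auto).
        assert (An : appr (fun N => a N /\ ~ Y N)) by auto using appr_and, appr_not.
        assert (At : appr (fun N => (a N /\ ~ close_tails C (history F K) N) /\ Y N))
          by auto using appr_and.
        apply Rle_trans with (mu (fun N => (a N /\ ~ Y N) \/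
          ((a N /\ ~ close_tails C (history F K) N) /\ Y N))).
        - apply mu_mono; auto using appr_or. intros N [h1 h2].
          destruct (classic (Y N)); tauto.
        - eapply Rle_trans; [apply mu_or_le; auto|]. apply Rplus_le_compat_l.
          apply mu_const_le; auto. exists 0%nat. intros n _.
          eapply Rle_trans; [|apply HtK]. apply dens_le.
          intros N _ [[h1 h2] [k Hk]]. exists k. split; auto.
          apply Nat.nlt_ge. intros L. apply h2. rewrite close_tails_history. eauto. }
      rewrite H0 in Hle. specialize (Hpos K).
      (* At most half of [r K] is lost after stage [K], so a positive part of [a] avoids [Y],
         against [H0]. *)
      assert (r K / 2 ^ (K + 1) <= r K / 2); [|lra].
      apply Rmult_le_compat_l; [lra|]. apply Rinv_le_contravar; [lra|].
      rewrite pow_add. pose proof (pow_R1_Rle 2 K ltac:(lra)). simpl. lra.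
Qed.

(** * The transfinite construction *)

Definition extends_well (S : (nat -> Prop) -> Prop) (C : nat -> cantor -> Prop)
  (Y : nat -> Prop) : Prop :=
  (appr Y /\ mu Y <= / 2 /\ exists f, forall k N, close_tail (C k) (f k) N -> Y N) /\
    forall a, gen S a -> (mu (fun N => a N /\ Y N) = 0 -> fin (fun N => a N /\ Y N)) /\
      (mu (fun N => a N /\ ~ Y N) = 0 -> fin (fun N => a N /\ ~ Y N)).

(** The sets that coincide with one old set on [Y] and with another off [Y] form an algebra
    containing [Y]. *)
Lemma gen_adjoin S Y a : gen (fun b => S b \/ b = Y) a ->
  exists b c, gen S b /\ gen S c /\ a = (fun N => b N /\ Y N \/ c N /\ ~ Y N).
Proof.
  assert (H1 : forall a, gen S a -> exists b c, gen S b /\ gen S c /\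
    a = (fun N => b N /\ Y N \/ c N /\ ~ Y N)).
  { intros b Hb. exists b, b. split; [|split]; auto. apply pred_ext. intros N.
    destruct (classic (Y N)); tauto. }
  induction 1 as [a [Ha| ->]|i|n|a Ha [b [c [Hb [Hc ->]]]]
    |a a' Ha [b [c [Hb [Hc ->]]]] Ha' [b' [c' [Hb' [Hc' ->]]]]].
  - apply H1. now apply gen_base.
  - exists (fun _ => True), (fun _ => False). split; [apply gen_true|split; [apply gen_false|]].
    apply pred_ext. tauto.
  - apply H1, gen_bit.
  - apply H1, gen_sing.
  - exists (fun N => ~ b N), (fun N => ~ c N). split; [|split]; try now apply gen_not.
    apply pred_ext. intros N. destruct (classic (Y N)); tauto.
  - exists (fun N => b N /\ b' N), (fun N => c N /\ c' N).
    split; [|split]; try now apply gen_and.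
    apply pred_ext. intros N. destruct (classic (Y N)); tauto.
Qed.

Lemma adjoin_null_fin S C Y a : (forall b, S b -> appr b) -> extends_well S C Y ->
  gen (fun b => S b \/ b = Y) a -> mu a = 0 -> fin a.
Proof.
  intros HS [[HY _] H] Ha H0.
  assert (Aa : appr a).
  { refine (gen_appr _ a _ Ha). intros b [Hb| ->]; auto. }
  apply gen_adjoin in Ha. destruct Ha as [b [c [Hb [Hc ->]]]].
  pose proof (gen_appr S b HS Hb). pose proof (gen_appr S c HS Hc).
  apply fin_or.
  - apply H; auto.
    refine (mu_null_sub _ _ _ Aa _ H0); auto using appr_and.
  - apply H; auto.
    refine (mu_null_sub _ _ _ Aa _ H0); auto using appr_and, appr_not.
Qed.

(** Start of the recursion: digit sets and singletons generate only finite modifications of sets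
    fixed by finitely many digits, and such a set is empty once it is null. *)
Lemma gen_empty_null_fin a : gen (fun _ => False) a -> mu a = 0 -> fin a.
Proof.
  intros Ha H0.
  assert (Aa : appr a) by (refine (gen_appr _ a _ Ha); tauto).
  assert (E : exists m c, dep m c /\ fin (symdiff a c)).
  { clear H0 Aa. induction Ha as [a []|i|n|a Ha [m [c [Hc IH]]]
      |a b Ha [m [c [Hc IH]]] Hb [m' [c' [Hc' IH']]]].
    - exists (S i), (fun N => bits N i = true). split.
      + intros N N' Hag HN. rewrite <- HN. symmetry. apply Hag. lia.
      + exists 0%nat. unfold symdiff. tauto.
    - exists 0%nat, (fun _ => False). split; [intros ? ? ? []|].
      exists (S n). unfold symdiff. intros N HN. apply NNPP. intros L. apply HN.
      split; [lia|tauto].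
    - exists m, (fun N => ~ c N). split; [now apply dep_not|].
      eapply fin_sub; [|apply IH]. unfold symdiff. intros N. tauto.
    - exists (max m m'), (fun N => c N /\ c' N). split.
      + apply dep_and; [apply (dep_le m)|apply (dep_le m')]; auto; lia.
      + eapply fin_sub; [|apply (fin_or _ _ IH IH')]. unfold symdiff. intros N HN.
        destruct (classic (a N <-> c N)); [right|left]; tauto. }
  destruct E as [m [c [Hc Hf]]].
  assert (Hc0 : mu c = 0).
  { pose proof (appr_dep m c Hc). pose proof (appr_fin _ Hf). apply Rle_antisym; [|now apply mu_nonneg].
    apply Rle_trans with (mu (fun N => a N \/ symdiff a c N)).
    - apply mu_mono; auto using appr_or. unfold symdiff. intros N HN. tauto.
    - eapply Rle_trans; [apply mu_or_le; auto|]. rewrite H0, mu_fin; auto. lra. }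
  eapply fin_sub; [|apply Hf]. intros N HN Hac.
  apply (dep_null m c Hc Hc0 N). tauto.
Qed.

Section Family.

Variables (J : Type) (lt : J -> J -> Prop).
Hypothesis lt_wf : well_founded lt.
Hypothesis lt_total : forall i j, lt i j \/ i = j \/ lt j i.
Hypothesis lt_trans : forall i j k, lt i j -> lt j k -> lt i k.

Definition below (Y : J -> nat -> Prop) (j : J) : (nat -> Prop) -> Prop :=
  fun a => exists i, lt i j /\ a = Y i.

(** Generating a set takes finitely many of the [Y i], and the largest index among them bounds the
    others. *)
Lemma gen_below_cases (Y : J -> nat -> Prop) (D : J -> Prop) a :
  gen (fun b => exists i, D i /\ b = Y i) a ->
  gen (fun _ => False) a \/
  exists i, D i /\ gen (fun b => below Y i b \/ b = Y i) a.
Proof.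
  assert (Hmono : forall i j a, lt i j -> gen (fun b => below Y i b \/ b = Y i) a ->
    gen (fun b => below Y j b \/ b = Y j) a).
  { intros i j b L. apply gen_mono. intros c [[k [Hk ->]]| ->]; left.
    - exists k. eauto.
    - exists i. auto. }
  assert (H0 : forall S a, gen (fun _ => False) a -> gen S a).
  { intros S b. apply gen_mono. tauto. }
  induction 1 as [a [i [Hi ->]]|i|n|a Ha [IH|[i [Hi IH]]]
    |a b Ha [IH|[i [Hi IH]]] Hb [IH'|[j [Hj IH']]]].
  - right. exists i. split; auto. apply gen_base. now right.
  - left. apply gen_bit.
  - left. apply gen_sing.
  - left. now apply gen_not.
  - right. exists i. split; auto. now apply gen_not.
  - left. now apply gen_and.
  - right. exists j. split; auto. apply gen_and; auto.
  - right. exists i. split; auto. apply gen_and; auto.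
  - right. destruct (lt_total i j) as [L|[->|L]].
    + exists j. split; auto. apply gen_and; eauto.
    + exists j. split; auto. apply gen_and; eauto.
    + exists i. split; auto. apply gen_and; eauto.
Qed.

(** Carries the absence of infinite null sets through limit stages. [D] is the segment below an
    index during the recursion, and all of [J] at the end. *)
Lemma gen_family_null_fin (Y : J -> nat -> Prop) (C : J -> nat -> cantor -> Prop)
  (D : J -> Prop) a :
  (forall i j, D j -> lt i j -> D i) ->
  (forall i, D i -> extends_well (below Y i) (C i) (Y i)) ->
  gen (fun b => exists i, D i /\ b = Y i) a -> mu a = 0 -> fin a.
Proof.
  intros HD H Ha. apply gen_below_cases in Ha. destruct Ha as [Ha|[i [Hi Ha]]].
  - now apply gen_empty_null_fin.
  - refine (adjoin_null_fin (below Y i) (C i) (Y i) a _ (H i Hi) Ha).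
    intros b [k [Hk ->]]. apply (H k). eauto.
Qed.

Lemma family_exists (C : J -> nat -> cantor -> Prop) :
  (forall j (g : J -> nat -> nat), exists G, forall i, lt i j ->
     exists m, forall n, (m <= n)%nat -> (g i n <= G n)%nat) ->
  (forall j k, in_E (C j k)) ->
  exists Y : J -> nat -> Prop,
    (forall j, appr (Y j) /\ mu (Y j) <= / 2 /\
       exists f, forall k N, close_tail (C j k) (f k) N -> Y j N) /\
    forall a, gen (fun b => exists j, b = Y j) a -> mu a = 0 -> fin a.
Proof.
  intros Hb HC.
  (* [epsilon] picks an extension of the earlier sets without knowing that one exists; existence is
     proved afterwards, by induction along the order. *)
  set (F := fun j (rec : forall i, lt i j -> nat -> Prop) =>
    epsilon (inhabits (fun _ : nat => True))
      (extends_well (fun a => exists i (h : lt i j), a = rec i h) (C j))).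
  set (Y := Fix lt_wf (fun _ => nat -> Prop) F).
  assert (E : forall j, Y j = epsilon (inhabits (fun _ : nat => True))
    (extends_well (below Y j) (C j))).
  { intros j. unfold Y. rewrite Fix_eq.
    - fold Y. unfold F. f_equal. f_equal. apply pred_ext. intros a. split.
      + intros [i [h Hi]]. now exists i.
      + intros [i [h Hi]]. now exists i, h.
    - intros i f g Hfg. f_equal. apply functional_extensionality_dep. intros k.
      apply functional_extensionality_dep. intros h. apply Hfg. }
  assert (H : forall j, extends_well (below Y j) (C j) (Y j)).
  { intros j. induction j as [j IH] using (well_founded_induction lt_wf).
    rewrite E. apply epsilon_spec.
    destruct (extension_step (below Y j) (C j)) as [Z [f [H1 [H2 [H3 H4]]]]].
    - intros a [i [Hi ->]]. apply (IH i Hi).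
    - intros a Ha. apply (gen_family_null_fin Y C (fun i => lt i j)); eauto.
    - intros g. destruct (Hb j (fun i => g (Y i))) as [G HG]. exists G.
      intros a [i [Hi ->]]. auto.
    - auto.
    - exists Z. split; [split; [|split]|]; eauto. }
  exists Y. split; [apply H|].
  intros a Ha. apply (gen_family_null_fin Y C (fun _ => True)); auto.
  eapply gen_mono; [|apply Ha]. intros b [j ->]. now exists j.
Qed.

End Family.

(** An order of the type of an initial ordinal. If some segment of a given well-order receives an
    injection of [J], the order is pulled back along such an injection into the segment of the least
    possible [x]; an injection of [J] into a segment of the new order would yield a point smaller
    than [x]. *)
Lemma small_well_order (J : Type) : exists lt : J -> J -> Prop,
  well_founded lt /\ (forall i j, lt i j \/ i = j \/ lt j i) /\
  (forall i j k, lt i j -> lt j k -> lt i k) /\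
  forall j, ~ injects J {i | lt i j}.
Proof.
  destruct (well_order_exists J) as [lt [Hwf [Htot Htr]]].
  destruct (classic (exists x, injects J {i | lt i x})) as [[x Hx]|Hn].
  - revert Hx. induction x as [x IH] using (well_founded_induction Hwf). intros [h Hh].
    destruct (classic (exists y, lt y x /\ injects J {i | lt i y})) as [[y [Hy Hi]]|Hn];
      [eauto|].
    assert (hinj : forall i j, proj1_sig (h i) = proj1_sig (h j) -> i = j).
    { intros i j Hij. apply Hh. destruct (h i) as [a Ha], (h j) as [b Hb]. simpl in Hij.
      subst b. f_equal. apply proof_irrelevance. }
    exists (fun i j => lt (proj1_sig (h i)) (proj1_sig (h j))).
    split; [|split; [|split]].
    + apply wf_inverse_image. exact Hwf.
    + intros i j. destruct (Htot (proj1_sig (h i)) (proj1_sig (h j))) as [|[|]]; auto.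
    + eauto.
    + intros j [k Hk]. apply Hn. exists (proj1_sig (h j)). split.
      * apply (proj2_sig (h j)).
      * exists (fun i => exist (fun i' => lt i' (proj1_sig (h j)))
          (proj1_sig (h (proj1_sig (k i)))) (proj2_sig (k i))).
        intros a b Hab. apply Hk. injection Hab as Hab. apply hinj in Hab.
        destruct (k a) as [a' Ha'], (k b) as [b' Hb']. simpl in Hab. subst b'. f_equal.
        apply proof_irrelevance.
  - exists lt. split; [|split; [|split]]; auto. intros j Hj. eauto.
Qed.

(** If the functions indexed by the segment were unbounded, [le_bounding J] would inject [J] into
    the segment. *)
Lemma initial_segments_bounded (J : Type) (lt : J -> J -> Prop) j :
  le_bounding J -> ~ injects J {i | lt i j} ->
  forall g : J -> nat -> nat, exists G, forall i, lt i j ->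
     exists m, forall n, (m <= n)%nat -> (g i n <= G n)%nat.
Proof.
  intros HJ Hn g. apply NNPP. intros N. apply Hn.
  apply (HJ _ (fun i => g (proj1_sig i))). intros [G HG]. apply N. exists G.
  intros i Hi. apply (HG (exist _ i Hi)).
Qed.

(** * The regular Borel measure induced by a measure on clopen sets *)

Section ClopenMeasure.

Variables (Y : Type) (Alg : (Y -> Prop) -> Prop) (nu : (Y -> Prop) -> R).

Hypothesis Alg_full : Alg (fun _ => True).
Hypothesis Alg_or : forall a b, Alg a -> Alg b -> Alg (fun y => a y \/ b y).
Hypothesis Alg_diff : forall a b, Alg a -> Alg b -> Alg (fun y => a y /\ ~ b y).
Hypothesis Alg_compact : forall a (F : (Y -> Prop) -> Prop), Alg a ->
  (forall b, F b -> Alg b) -> (forall y, a y -> exists b, F b /\ b y) ->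
  exists l, (forall b, In b l -> F b) /\ forall y, a y -> exists b, In b l /\ b y.
Hypothesis nu_full : nu (fun _ => True) = 1.
Hypothesis nu_pos : forall a, Alg a -> 0 <= nu a.
Hypothesis nu_add : forall a b, Alg a -> Alg b ->
  (forall y, a y -> b y -> False) -> nu (fun y => a y \/ b y) = nu a + nu b.

Definition alg_open (O : Y -> Prop) : Prop :=
  forall y, O y -> exists a, Alg a /\ a y /\ forall z, a z -> O z.

Lemma Alg_empty : Alg (fun _ => False).
Proof.
  replace (fun _ : Y => False) with (fun y : Y => True /\ ~ True).
  - apply (Alg_diff _ _ Alg_full Alg_full).
  - apply pred_ext. tauto.
Qed.

Lemma nu_mono a b : Alg a -> Alg b -> (forall y, a y -> b y) -> nu a <= nu b.
Proof.
  intros Ha Hb H.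
  replace b with (fun y => a y \/ (b y /\ ~ a y)).
  - rewrite nu_add; auto; try tauto.
    pose proof (nu_pos _ (Alg_diff _ _ Hb Ha)). lra.
  - apply pred_ext. intros y. specialize (H y). destruct (classic (a y)); tauto.
Qed.

Lemma nu_or_le a b : Alg a -> Alg b -> nu (fun y => a y \/ b y) <= nu a + nu b.
Proof.
  intros Ha Hb.
  replace (fun y => a y \/ b y) with (fun y => a y \/ (b y /\ ~ a y)).
  - rewrite nu_add; auto; try tauto.
    apply Rplus_le_compat_l, nu_mono; auto; tauto.
  - apply pred_ext. intros y. destruct (classic (a y)); tauto.
Qed.

Lemma inner_exists O :
  exists r, is_lub (fun r => exists a, Alg a /\ (forall y, a y -> O y) /\ r = nu a) r.
Proof.
  destruct (completeness (fun r => exists a, Alg a /\ (forall y, a y -> O y) /\ r = nu a))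
    as [r Hr].
  - exists 1. intros r [a [Ha [_ ->]]]. rewrite <- nu_full. apply nu_mono; auto.
  - exists (nu (fun _ => False)), (fun _ => False). split; [apply Alg_empty|tauto].
  - now exists r.
Qed.

Definition inner (O : Y -> Prop) : R :=
  epsilon (inhabits 0)
    (is_lub (fun r => exists a, Alg a /\ (forall y, a y -> O y) /\ r = nu a)).

Lemma inner_lub O :
  is_lub (fun r => exists a, Alg a /\ (forall y, a y -> O y) /\ r = nu a) (inner O).
Proof. exact (epsilon_spec (inhabits 0) _ (inner_exists O)). Qed.

Lemma inner_ge a O : Alg a -> (forall y, a y -> O y) -> nu a <= inner O.
Proof. intros Ha H. apply (proj1 (inner_lub O)). now exists a. Qed.

Lemma inner_le O r :
  (forall a, Alg a -> (forall y, a y -> O y) -> nu a <= r) -> inner O <= r.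
Proof.
  intros H. apply (proj2 (inner_lub O)). intros x [a [Ha [Hs ->]]]. auto.
Qed.

Lemma inner_approx O e : 0 < e ->
  exists a, Alg a /\ (forall y, a y -> O y) /\ inner O - e <= nu a.
Proof.
  intros He. apply NNPP. intros N.
  assert (inner O <= inner O - e); [|lra].
  apply inner_le. intros a Ha Hs. apply Rnot_lt_le. intros L.
  apply N. exists a. split; [|split]; auto. lra.
Qed.

Lemma inner_mono O P : (forall y, O y -> P y) -> inner O <= inner P.
Proof. intros H. apply inner_le. intros a Ha Hs. apply inner_ge; auto. Qed.

Lemma inner_alg a : Alg a -> inner a = nu a.
Proof.
  intros Ha. apply Rle_antisym.
  - apply inner_le. intros b Hb H. now apply nu_mono.
  - now apply inner_ge.
Qed.

Lemma inner_nonneg O : 0 <= inner O.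
Proof.
  eapply Rle_trans; [apply nu_pos, Alg_empty|]. apply inner_ge; [apply Alg_empty|tauto].
Qed.

Lemma alg_open_alg a : Alg a -> alg_open a.
Proof. intros Ha y Hy. exists a. auto. Qed.

Lemma alg_open_compl a : Alg a -> alg_open (fun y => ~ a y).
Proof.
  intros Ha. apply alg_open_alg.
  replace (fun y => ~ a y) with (fun y => True /\ ~ a y) by (apply pred_ext; tauto).
  now apply Alg_diff.
Qed.

Lemma alg_open_and O P : alg_open O -> alg_open P -> alg_open (fun y => O y /\ P y).
Proof.
  intros HO HP y [Hy Hy'].
  destruct (HO y Hy) as [a [Ha [ay aO]]], (HP y Hy') as [b [Hb [By bP]]].
  exists (fun y => a y /\ ~ (a y /\ ~ b y)). split; [|split].
  - auto.
  - tauto.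
  - intros z [Hz Hz']. split; auto. apply bP. tauto.
Qed.

Lemma alg_open_or O P : alg_open O -> alg_open P -> alg_open (fun y => O y \/ P y).
Proof.
  intros HO HP y [Hy|Hy].
  - destruct (HO y Hy) as [a [Ha [ay aO]]]. exists a; auto.
  - destruct (HP y Hy) as [a [Ha [ay aO]]]. exists a; auto.
Qed.

Lemma alg_open_ex {I : Type} (O : I -> Y -> Prop) :
  (forall i, alg_open (O i)) -> alg_open (fun y => exists i, O i y).
Proof.
  intros H y [i Hi]. destruct (H i y Hi) as [a [Ha [ay aO]]].
  exists a. split; [|split]; eauto.
Qed.

(** A member of the algebra inside the union is compact, so finitely many members cover it, each
    inside [O] or inside [P]; they are united in two groups. *)
Lemma inner_or_le O P : alg_open O -> alg_open P ->
  inner (fun y => O y \/ P y) <= inner O + inner P.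
Proof.
  intros HO HP. apply inner_le. intros a Ha Hs.
  destruct (Alg_compact a (fun b => Alg b /\
    ((forall y, b y -> O y) \/ (forall y, b y -> P y))) Ha) as [l [Hl Hc]].
  - now intros b [].
  - intros y Hy. destruct (Hs y Hy) as [H|H].
    + destruct (HO y H) as [b [Hb [By bO]]]. exists b; auto.
    + destruct (HP y H) as [b [Hb [By bO]]]. exists b; auto.
  - assert (S : exists b c, Alg b /\ Alg c /\ (forall y, b y -> O y) /\
      (forall y, c y -> P y) /\ forall d, In d l -> forall y, d y -> b y \/ c y).
    { clear Hc Ha Hs. induction l as [|d l IH].
      - exists (fun _ => False), (fun _ => False).
        split; [apply Alg_empty|]. split; [apply Alg_empty|]. simpl. tauto.
      - destruct IH as [b [c [Hb [Hc [bO [cP H]]]]]].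
        { intros b Hb. apply Hl. now right. }
        destruct (Hl d (or_introl eq_refl)) as [Hd [dO|dP]].
        + exists (fun y => d y \/ b y), c. repeat split; auto.
          * intros y []; auto.
          * intros d' [<-|Hd'] y Hy; auto. destruct (H d' Hd' y Hy); auto.
        + exists b, (fun y => d y \/ c y). repeat split; auto.
          * intros y []; auto.
          * intros d' [<-|Hd'] y Hy; auto. destruct (H d' Hd' y Hy); auto. }
    destruct S as [b [c [Hb [Hc' [bO [cP H]]]]]].
    apply Rle_trans with (nu b + nu c).
    + eapply Rle_trans; [|now apply nu_or_le]. apply nu_mono; auto.
      intros y Hy. destruct (Hc y Hy) as [d [Hd Hdy]]. eauto.
    + apply Rplus_le_compat; now apply inner_ge.
Qed.

Lemma inner_sum_le (O : nat -> Y -> Prop) N : (forall n, alg_open (O n)) ->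
  inner (fun y => exists n, (n <= N)%nat /\ O n y) <= sum_f_R0 (fun n => inner (O n)) N.
Proof.
  intros H. induction N as [|N IH]; simpl.
  - apply inner_mono. intros y [n [Hn Hy]]. now replace n with 0%nat in Hy by lia.
  - eapply Rle_trans; [|apply Rplus_le_compat_r, IH].
    eapply Rle_trans; [|apply inner_or_le; auto].
    + apply inner_mono. intros y [n [Hn Hy]].
      destruct (Nat.eq_dec n (S N)) as [->|]; [now right|left].
      exists n. split; auto. lia.
    + intros y [n [Hn Hy]]. destruct (H n y Hy) as [a [Ha [ay aO]]].
      exists a. split; [|split]; eauto.
Qed.

Lemma alg_finite_cover a (O : nat -> Y -> Prop) : Alg a -> (forall n, alg_open (O n)) ->
  (forall y, a y -> exists n, O n y) ->
  exists N, forall y, a y -> exists n, (n <= N)%nat /\ O n y.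
Proof.
  intros Ha HO Hc.
  destruct (Alg_compact a (fun b => Alg b /\ exists n, forall y, b y -> O n y) Ha)
    as [l [Hl Hl']].
  - now intros b [].
  - intros y Hy. destruct (Hc y Hy) as [n Hn].
    destruct (HO n y Hn) as [b [Hb [By bO]]]. exists b. split; eauto.
  - assert (S : exists N, forall b, In b l -> exists n, (n <= N)%nat /\ forall y, b y -> O n y).
    { clear Hl'. induction l as [|d l IH].
      - exists 0%nat. intros b [].
      - destruct IH as [N HN]. { intros b Hb. apply Hl. now right. }
        destruct (Hl d (or_introl eq_refl)) as [_ [n Hn]].
        exists (max n N). intros b [<-|Hb].
        + exists n. split; [lia|auto].
        + destruct (HN b Hb) as [k [Hk Hk']]. exists k. split; [lia|auto]. }
    destruct S as [N HN]. exists N. intros y Hy.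
    destruct (Hl' y Hy) as [b [Hb By]]. destruct (HN b Hb) as [n [Hn Hn']]. eauto.
Qed.

(** By compactness, a member of the algebra inside the union already lies in finitely many of the
    [O n]. *)
Lemma inner_ex_le (O : nat -> Y -> Prop) r : (forall n, alg_open (O n)) ->
  (forall N, sum_f_R0 (fun n => inner (O n)) N <= r) ->
  inner (fun y => exists n, O n y) <= r.
Proof.
  intros HO Hr. apply inner_le. intros a Ha Hs.
  destruct (alg_finite_cover a O Ha HO Hs) as [N HN].
  eapply Rle_trans; [|apply (Hr N)]. eapply Rle_trans; [|apply inner_sum_le, HO].
  apply inner_ge; auto.
Qed.

Lemma inner_alg_split a O : Alg a -> (forall y, a y -> O y) ->
  nu a + inner (fun y => O y /\ ~ a y) <= inner O.
Proof.
  intros Ha Hs.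
  assert (inner (fun y => O y /\ ~ a y) <= inner O - nu a); [|lra].
  apply inner_le. intros b Hb Hb'.
  assert (nu (fun y => a y \/ b y) <= inner O).
  { apply inner_ge; auto. intros y [|H]; auto. now apply Hb'. }
  rewrite nu_add in H; auto. 2:{ intros y H1 H2. now apply (Hb' y). }
  lra.
Qed.

Lemma outer_exists B : exists r,
  (forall O, alg_open O -> (forall y, B y -> O y) -> r <= inner O) /\
  (forall e, 0 < e -> exists O, alg_open O /\ (forall y, B y -> O y) /\ inner O <= r + e).
Proof.
  (* The infimum over open supersets is obtained as a negated supremum of negated values. *)
  destruct (completeness (fun r => exists O, alg_open O /\ (forall y, B y -> O y)
    /\ r = - inner O)) as [r [H1 H2]].
  - exists 0. intros r [O [_ [_ ->]]]. pose proof (inner_nonneg O). lra.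
  - exists (- inner (fun _ => True)), (fun _ => True).
    split; [|auto]. apply alg_open_alg, Alg_full.
  - exists (- r). split.
    + intros O HO HB. assert (- inner O <= r); [|lra]. apply H1. now exists O.
    + intros e He. apply NNPP. intros N. assert (r <= r - e); [|lra].
      apply H2. intros x [O [HO [HB ->]]]. apply Rnot_lt_le. intros L.
      apply N. exists O. split; [|split]; auto. lra.
Qed.

Definition outer (B : Y -> Prop) : R := epsilon (inhabits 0) (fun r =>
  (forall O, alg_open O -> (forall y, B y -> O y) -> r <= inner O) /\
  (forall e, 0 < e -> exists O, alg_open O /\ (forall y, B y -> O y) /\ inner O <= r + e)).

Lemma outer_le B O : alg_open O -> (forall y, B y -> O y) -> outer B <= inner O.
Proof. apply (proj1 (epsilon_spec (inhabits 0) _ (outer_exists B))). Qed.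

Lemma outer_approx B e : 0 < e ->
  exists O, alg_open O /\ (forall y, B y -> O y) /\ inner O <= outer B + e.
Proof. apply (proj2 (epsilon_spec (inhabits 0) _ (outer_exists B))). Qed.

Lemma outer_ge B r :
  (forall O, alg_open O -> (forall y, B y -> O y) -> r <= inner O) -> r <= outer B.
Proof.
  intros H. apply Rnot_lt_le. intros L.
  destruct (outer_approx B ((r - outer B) / 2)) as [O [HO [HB He]]]; [lra|].
  specialize (H O HO HB). lra.
Qed.

Lemma outer_open O : alg_open O -> outer O = inner O.
Proof.
  intros HO. apply Rle_antisym.
  - now apply outer_le.
  - apply outer_ge. intros P HP H. now apply inner_mono.
Qed.

Lemma outer_mono A B : (forall y, A y -> B y) -> outer A <= outer B.
Proof. intros H. apply outer_ge. intros O HO HB. apply outer_le; auto. Qed.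

Lemma outer_nonneg A : 0 <= outer A.
Proof. apply outer_ge. intros. apply inner_nonneg. Qed.

Lemma outer_or_le A B : outer (fun y => A y \/ B y) <= outer A + outer B.
Proof.
  apply le_epsilon. intros e He.
  destruct (outer_approx A (e / 2)) as [O [HO [HA HO']]]; [lra|].
  destruct (outer_approx B (e / 2)) as [P [HP [HB HP']]]; [lra|].
  assert (outer (fun y => A y \/ B y) <= inner (fun y => O y \/ P y)).
  { apply outer_le; [now apply alg_open_or|]. intros y []; auto. }
  pose proof (inner_or_le O P HO HP). lra.
Qed.

Lemma sum_half_pow_le e N : 0 < e -> sum_f_R0 (fun n => e * (/ 2) ^ S n) N <= e.
Proof.
  intros He.
  assert (H : sum_f_R0 (fun n => e * (/ 2) ^ S n) N = e - e * (/ 2) ^ S N).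
  { induction N as [|N IH]; simpl in *; [field|]. rewrite IH. field. }
  rewrite H. assert (0 < e * (/ 2) ^ S N); [|lra].
  apply Rmult_lt_0_compat; auto. apply pow_lt. lra.
Qed.

Lemma outer_ex_le (A : nat -> Y -> Prop) r :
  (forall N, sum_f_R0 (fun n => outer (A n)) N <= r) ->
  outer (fun y => exists n, A n y) <= r.
Proof.
  intros Hr. apply le_epsilon. intros e He.
  assert (Hch : forall n, exists O, alg_open O /\ (forall y, A n y -> O y) /\
    inner O <= outer (A n) + e * (/ 2) ^ S n).
  { intros n. apply outer_approx. apply Rmult_lt_0_compat; auto. apply pow_lt. lra. }
  apply choice in Hch. destruct Hch as [O HO].
  eapply Rle_trans; [apply (outer_le _ (fun y => exists n, O n y))|].
  - apply alg_open_ex. apply HO.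
  - intros y [n Hn]. exists n. now apply HO.
  - apply inner_ex_le; [apply HO|]. intros N.
    apply Rle_trans with (sum_f_R0 (fun n => outer (A n) + e * (/ 2) ^ S n) N).
    + apply sum_Rle. intros n _. apply HO.
    + rewrite sum_plus. apply Rplus_le_compat; auto. now apply sum_half_pow_le.
Qed.

(** Takes the place of measurability: the sandwiched sets include the open ones and are closed under
    complements and countable unions, [outer] is additive on them, and inner regularity comes with
    the definition. *)
Definition sandwiched (B : Y -> Prop) : Prop := forall e, 0 < e ->
  exists O C, alg_open O /\ alg_open (fun y => ~ C y) /\ (forall y, C y -> B y) /\
    (forall y, B y -> O y) /\ inner (fun y => O y /\ ~ C y) <= e.

Lemma sandwiched_open O : alg_open O -> sandwiched O.
Proof.
  intros HO e He. destruct (inner_approx O e He) as [a [Ha [aO H]]].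
  exists O, a. split; [|split; [|split; [|split]]]; auto.
  - now apply alg_open_compl.
  - pose proof (inner_alg_split a O Ha aO). lra.
Qed.

Lemma sandwiched_compl B : sandwiched B -> sandwiched (fun y => ~ B y).
Proof.
  intros H e He. destruct (H e He) as [O [C [HO [HC [CB [BO Hi]]]]]].
  exists (fun y => ~ C y), (fun y => ~ O y).
  split; [|split; [|split; [|split]]]; auto.
  - intros y Hy. destruct (HO y) as [a [Ha [ay aO]]]; [now apply NNPP|].
    exists a. split; [|split]; auto.
  - eapply Rle_trans; [|apply Hi]. apply inner_mono.
    intros y [h1 h2]. split; auto. now apply NNPP.
Qed.

Lemma sandwiched_ex (B : nat -> Y -> Prop) :
  (forall n, sandwiched (B n)) -> sandwiched (fun y => exists n, B n y).
Proof.
  intros H e He.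
  assert (Hch : forall n, exists OC : (Y -> Prop) * (Y -> Prop),
    alg_open (fst OC) /\ alg_open (fun y => ~ snd OC y) /\ (forall y, snd OC y -> B n y) /\
    (forall y, B n y -> fst OC y) /\
    inner (fun y => fst OC y /\ ~ snd OC y) <= e / 2 * (/ 2) ^ S n).
  { intros n. destruct (H n (e / 2 * (/ 2) ^ S n)) as [O [C HOC]].
    - apply Rmult_lt_0_compat; [lra|]. apply pow_lt. lra.
    - now exists (O, C). }
  apply choice in Hch. destruct Hch as [OC HOC].
  set (O := fun n => fst (OC n)). set (C := fun n => snd (OC n)).
  assert (HO : alg_open (fun y => exists n, O n y)).
  { apply alg_open_ex. intros n. apply HOC. }
  (* A countable union of closed sets need not be closed, so only finitely many [C n] can be kept. A
     clopen [a] that nearly fills the union of the [O n] is compact, and the number [N] of sets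
     needed to cover it tells how many. *)
  destruct (inner_approx _ (e / 2) ltac:(lra) : exists a, Alg a /\
    (forall y, a y -> exists n, O n y) /\ inner (fun y => exists n, O n y) - e / 2 <= nu a)
    as [a [Ha [aO Hai]]].
  destruct (alg_finite_cover a O Ha) as [N HN]; auto.
  { intros n. apply HOC. }
  exists (fun y => exists n, O n y), (fun y => exists n, (n <= N)%nat /\ C n y).
  split; [|split; [|split; [|split]]]; auto.
  - clear HN. induction N as [|N IH].
    + replace (fun y => ~ exists n, (n <= 0)%nat /\ C n y) with (fun y => ~ C 0%nat y).
      * apply HOC.
      * apply pred_ext. intros y. split.
        -- intros h [n [Hn Hn']]. now replace n with 0%nat in Hn' by lia.
        -- intros h h'. apply h. now exists 0%nat.
    + replace (fun y => ~ exists n, (n <= S N)%nat /\ C n y) with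
        (fun y => (~ exists n, (n <= N)%nat /\ C n y) /\ ~ C (S N) y).
      * apply alg_open_and; auto. apply HOC.
      * apply pred_ext. intros y. split.
        -- intros [h h'] [n [Hn Hn']]. destruct (Nat.eq_dec n (S N)) as [->|]; auto.
           apply h. exists n. split; auto. lia.
        -- intros h. split; intros h'; apply h; eauto.
           destruct h' as [n [Hn Hn']]. exists n. split; auto.
  - intros y [n [_ Hn]]. exists n. now apply HOC.
  - intros y [n Hn]. exists n. now apply HOC.
  - set (D := fun n y => O n y /\ ~ C n y).
    assert (HD : forall n, alg_open (D n)).
    { intros n. apply alg_open_and; apply HOC. }
    (* The error consists of the part of the open union outside [a] and of the gaps [D n]; each of
       the two contributes at most [e / 2]. *)
    apply Rle_trans with (inner (fun y => ((exists n, O n y) /\ ~ a y) \/ exists n, D n y)).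
    + apply inner_mono. intros y [hO hC]. destruct (classic (a y)) as [ha|ha]; [|now left].
      right. destruct (HN y ha) as [n [Hn Hn']]. exists n. split; auto.
      intros hc. apply hC. now exists n.
    + eapply Rle_trans; [apply inner_or_le|].
      * apply alg_open_and; auto. now apply alg_open_compl.
      * now apply alg_open_ex.
      * pose proof (inner_alg_split a _ Ha aO).
        assert (inner (fun y => exists n, D n y) <= e / 2); [|lra].
        apply inner_ex_le; auto. intros M.
        eapply Rle_trans; [|apply (sum_half_pow_le (e / 2) M); lra].
        apply sum_Rle. intros n _. apply HOC.
Qed.

Lemma sandwiched_closed_approx B e : sandwiched B -> 0 < e ->
  exists C, alg_open (fun y => ~ C y) /\ (forall y, C y -> B y) /\ outer B - e <= outer C.
Proof.
  intros HB He. destruct (HB e He) as [O [C [HO [HC [CB [BO Hi]]]]]].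
  exists C. split; [|split]; auto.
  pose proof (outer_or_le C (fun y => O y /\ ~ C y)) as H.
  rewrite (outer_open (fun y => O y /\ ~ C y)) in H by now apply alg_open_and.
  assert (outer B <= outer (fun y => C y \/ O y /\ ~ C y)).
  { apply outer_mono. intros y Hy. destruct (classic (C y)); auto. }
  lra.
Qed.

(* A clopen set nearly filling [O \ C], where [C] is a closed part of [A] and [O] is an
   open superset of [A] and [B], carries almost all of [outer B]; its complement in [O]
   still contains [C]. *)
Lemma outer_or_ge A B : sandwiched A -> (forall y, A y -> B y -> False) ->
  outer A + outer B <= outer (fun y => A y \/ B y).
Proof.
  intros HA Hd. apply outer_ge. intros O HO HAB. apply le_epsilon. intros e He.
  destruct (sandwiched_closed_approx A (e / 2) HA) as [C [HC [CA HCi]]]; [lra|].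
  destruct (inner_approx (fun y => O y /\ ~ C y) (e / 2)) as [a [Ha [aO Hai]]]; [lra|].
  assert (outer B <= inner (fun y => O y /\ ~ C y)).
  { apply outer_le; [now apply alg_open_and|]. intros y Hy. split; auto.
    intros hc. eauto. }
  assert (outer C <= inner (fun y => O y /\ ~ a y)).
  { apply outer_le.
    - apply alg_open_and; auto. now apply alg_open_compl.
    - intros y Hy. split; auto. intros ha. now apply (aO y). }
  pose proof (inner_alg_split a O Ha (fun y h => proj1 (aO y h))). lra.
Qed.

Lemma borel_sandwiched B : borel alg_open B -> sandwiched B.
Proof.
  intros H. apply H.
  - apply sandwiched_open.
  - apply sandwiched_compl.
  - apply sandwiched_ex.
Qed.

(** Finite additivity on Borel sets bounds the partial sums by the measure of the union; countable
    subadditivity shows that they come arbitrarily close to it. *)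
Lemma outer_prob : borel_prob_measure alg_open outer.
Proof.
  split; [|split].
  - rewrite outer_open by apply alg_open_alg, Alg_full.
    rewrite inner_alg; auto using Alg_full.
  - intros B _. apply outer_nonneg.
  - intros A HA Hd.
    set (s := sum_f_R0 (fun n => outer (A n))).
    assert (Hs : forall N, s N <= outer (fun y => exists n, A n y)).
    { intros N.
      assert (H : s N <= outer (fun y => exists n, (n <= N)%nat /\ A n y)).
      { unfold s. induction N as [|N IH]; simpl.
        - apply outer_mono. intros y Hy. now exists 0%nat.
        - eapply Rle_trans; [apply Rplus_le_compat_r, IH|].
          rewrite Rplus_comm.
          eapply Rle_trans; [apply outer_or_ge|].
          + now apply borel_sandwiched.
          + intros y Hy [n [Hn Hn']]. apply (Hd n (S N) y); auto. lia.
          + apply outer_mono. intros y [Hy|[n [Hn Hy]]].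
            * now exists (S N).
            * exists n. split; auto. }
      eapply Rle_trans; [apply H|]. apply outer_mono. intros y [n [_ Hn]]. eauto. }
    intros e He.
    assert (Hex : exists N, outer (fun y => exists n, A n y) - e < s N).
    { apply NNPP. intros Nx.
      assert (outer (fun y => exists n, A n y) <= outer (fun y => exists n, A n y) - e); [|lra].
      apply outer_ex_le. intros N. apply Rnot_lt_le. intros L. apply Nx. now exists N. }
    destruct Hex as [N HN]. exists N. intros n Hn.
    assert (s N <= s n).
    { unfold ge in Hn. unfold s. induction Hn as [|n Hn IH]; [lra|]. simpl.
      pose proof (outer_nonneg (A (S n))). lra. }
    specialize (Hs n). unfold Rdist. fold (s n).
    rewrite Rabs_left1; lra.
Qed.

Lemma outer_regular : regular_measure alg_open outer.
Proof.
  intros B HB e He. split.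
  - destruct (outer_approx B e He) as [O [HO [BO H]]].
    exists O. rewrite outer_open; auto.
  - destruct (sandwiched_closed_approx B e (borel_sandwiched B HB) He) as [C [HC [CB H]]].
    exists C. auto.
Qed.

Lemma outer_strictly_positive :
  (forall a, Alg a -> (exists y, a y) -> 0 < nu a) -> strictly_positive alg_open outer.
Proof.
  intros H O HO [y Hy]. destruct (HO y Hy) as [a [Ha [ay aO]]].
  rewrite outer_open by auto.
  apply Rlt_le_trans with (nu a); [|now apply inner_ge]. eauto.
Qed.

End ClopenMeasure.

(** * The Stone space and its remainder *)

Section Stone.

Variable S : (nat -> Prop) -> Prop.

(** Requiring the members of [u] to lie in the algebra makes equality of points the same as equality
    on the algebra, as [stone_ext] needs. *)
Definition ultra_on (u : (nat -> Prop) -> Prop) : Prop :=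
  (forall a, u a -> gen S a) /\ (forall a, u a -> exists N, a N) /\
  (forall a b, u a -> u b -> u (fun N => a N /\ b N)) /\
  (forall a, gen S a -> u a \/ u (fun N => ~ a N)).

Definition stone : Type := {u | ultra_on u}.

Definition mem (x : stone) (a : nat -> Prop) : Prop := proj1_sig x a.

Lemma mem_gen x a : mem x a -> gen S a.
Proof. destruct x as [u Hu]. apply Hu. Qed.

Lemma mem_ex x a : mem x a -> exists N, a N.
Proof. destruct x as [u Hu]. apply Hu. Qed.

Lemma mem_and x a b : mem x a -> mem x b -> mem x (fun N => a N /\ b N).
Proof. destruct x as [u Hu]. apply Hu. Qed.

Lemma mem_em x a : gen S a -> mem x a \/ mem x (fun N => ~ a N).
Proof. destruct x as [u Hu]. apply Hu. Qed.

Lemma mem_up x a b : mem x a -> gen S b -> (forall N, a N -> b N) -> mem x b.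
Proof.
  intros Ha Hb H. destruct (mem_em x b Hb) as [|Hn]; auto.
  destruct (mem_ex x _ (mem_and x _ _ Ha Hn)) as [N [h1 h2]]. exfalso. auto.
Qed.

Lemma mem_not x a : gen S a -> (mem x (fun N => ~ a N) <-> ~ mem x a).
Proof.
  intros Ha. split.
  - intros Hn H. destruct (mem_ex x _ (mem_and x _ _ H Hn)) as [N [h1 h2]]. auto.
  - intros H. destruct (mem_em x a Ha); tauto.
Qed.

Lemma mem_or x a b : gen S a -> gen S b ->
  (mem x (fun N => a N \/ b N) <-> mem x a \/ mem x b).
Proof.
  intros Ha Hb. split.
  - intros H. destruct (mem_em x a Ha) as [|Hn]; auto. right.
    apply (mem_up x _ b (mem_and x _ _ H Hn)); auto. tauto.
  - intros [H|H]; eapply mem_up; eauto using gen_or.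
Qed.

Lemma mem_diff x a b : gen S a -> gen S b ->
  (mem x (fun N => a N /\ ~ b N) <-> mem x a /\ ~ mem x b).
Proof.
  intros Ha Hb. rewrite <- (mem_not x b Hb). split.
  - intros H. split; apply (mem_up x _ _ H); auto using gen_not; tauto.
  - intros [H1 H2]. now apply mem_and.
Qed.

Lemma mem_true x : mem x (fun _ => True).
Proof.
  destruct (mem_em x _ (gen_true S)) as [|H]; auto.
  destruct (mem_ex x _ H) as [N HN]. tauto.
Qed.

Lemma mem_list x l : (forall a, In a l -> mem x a) -> mem x (fun N => forall a, In a l -> a N).
Proof.
  induction l as [|b l IH]; intros H.
  - replace (fun N : nat => forall a, In a nil -> a N) with (fun _ : nat => True);
      [apply mem_true|]. apply pred_ext. intros N. split; auto. intros _ a [].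
  - replace (fun N : nat => forall a, In a (b :: l) -> a N) with
      (fun N => b N /\ forall a, In a l -> a N).
    + apply mem_and; [apply H; now left|]. apply IH. intros a Ha. apply H. now right.
    + apply pred_ext. intros N. simpl. split.
      * intros [h1 h2] a [<-|Ha]; [exact h1|exact (h2 a Ha)].
      * intros h. split; [apply h; now left|]. intros a Ha. apply h. now right.
Qed.

Lemma stone_ext x y : (forall a, mem x a -> mem y a) -> x = y.
Proof.
  intros H. assert (E : proj1_sig x = proj1_sig y).
  { apply pred_ext. intros a. split; [apply H|]. intros Ha.
    destruct (mem_em x a (mem_gen y a Ha)) as [|Hn]; auto.
    apply H, mem_not in Hn; [contradiction|]. now apply (mem_gen y). }
  destruct x as [u Hu], y as [v Hv]. simpl in E. subst v. f_equal. apply proof_irrelevance.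
Qed.

Lemma stone_extend (F : (nat -> Prop) -> Prop) :
  (forall l, (forall a, In a l -> F a) -> exists N, forall a, In a l -> a N) ->
  exists x : stone, forall a, F a -> gen S a -> mem x a.
Proof.
  intros HF. destruct (ultra_extend F HF) as [u [Hu H]].
  assert (U : ultra_on (fun a => gen S a /\ u a)).
  { split; [|split; [|split]].
    - tauto.
    - intros a [_ Ha]. now apply (ultra_ex u Hu).
    - intros a b [Ha Ua] [Hb Ub]. split; [now apply gen_and|now apply (ultra_and u Hu)].
    - intros a Ha. destruct (ultra_em u Hu a); [left|right]; auto using gen_not. }
  exists (exist _ _ U). intros a Fa Ha. split; auto.
Qed.

Definition stone_op (U : stone -> Prop) : Prop :=
  forall x, U x -> exists a, mem x a /\ forall y, mem y a -> U y.

Lemma principal_ultra n : ultra_on (fun a => gen S a /\ a n).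
Proof.
  split; [|split; [|split]].
  - tauto.
  - intros a [_ H]. now exists n.
  - intros a b [Ha H] [Hb H']. split; auto. now apply gen_and.
  - intros a Ha. destruct (classic (a n)); [left|right]; auto using gen_not.
Qed.

Definition principal (n : nat) : stone := exist _ _ (principal_ultra n).

Lemma mem_sing x n : mem x (fun N => N = n) -> principal n = x.
Proof.
  intros H. apply stone_ext. intros a [Ha Hn]. apply (mem_up x _ a H Ha). now intros N ->.
Qed.

(** Without a finite subcover, the complements of the basic sets contained in members of the cover
    have the finite intersection property; a point containing them all would be uncovered. *)
Lemma stone_compact : Defs.compact stone_op.
Proof.
  intros I F Hop Hcov. apply NNPP. intros Hn.
  destruct (stone_extend (fun b => exists a i, gen S a /\
    (forall y, mem y a -> F i y) /\ b = (fun N => ~ a N))) as [x Hx].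
  - intros l Hl. apply NNPP. intros HN. apply Hn.
    assert (E : exists li, forall y, (exists i, In i li /\ F i y) \/
      forall b, In b l -> mem y b).
    { clear HN. induction l as [|b l IH].
      - exists nil. intros y. right. intros b [].
      - destruct IH as [li Hli]. { intros c Hc. apply Hl. now right. }
        destruct (Hl b (or_introl eq_refl)) as [a [i [Ha [Hi ->]]]].
        exists (i :: li). intros y. destruct (Hli y) as [[k [Hk Hk']]|H].
        + left. exists k. split; auto. now right.
        + destruct (mem_em y a Ha) as [h|h].
          * left. exists i. split; auto. now left.
          * right. intros c [<-|Hc]; auto. }
    destruct E as [li Hli]. exists li. intros y. destruct (Hli y) as [|H]; auto.
    exfalso. apply HN. exact (mem_ex y _ (mem_list y l H)).
  - destruct (Hcov x) as [i Hi]. destruct (Hop i x Hi) as [a [Ha HaF]].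
    pose proof (mem_gen x a Ha) as Ga.
    assert (Hna : mem x (fun N => ~ a N)) by (apply Hx; eauto using gen_not).
    apply mem_not in Hna; auto.
Qed.

Lemma stone_compactification : compactification_of_omega stone_op principal.
Proof.
  split; [|split; [exact stone_compact|split; [|split; [|split]]]].
  - split; [|split].
    + intros x _. exists (fun _ => True). split; auto. apply mem_true.
    + intros U V HU HV x [Hx Hx'].
      destruct (HU x Hx) as [a [Ha HaU]], (HV x Hx') as [b [Hb HbV]].
      exists (fun N => a N /\ b N). split; [now apply mem_and|].
      pose proof (mem_gen x a Ha). pose proof (mem_gen x b Hb).
      intros y Hy. split; [apply HaU|apply HbV]; apply (mem_up y _ _ Hy); auto; tauto.
    + intros I F HF x [i Hi]. destruct (HF i x Hi) as [a [Ha HaF]].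
      exists a. split; eauto.
  - intros x y Hxy.
    assert (E : exists a, mem x a /\ ~ mem y a).
    { apply NNPP. intros N. apply Hxy. apply stone_ext. intros a Ha. apply NNPP.
      intros Hn. apply N. now exists a. }
    destruct E as [a [Hx Hy]]. pose proof (mem_gen x a Hx) as Ha.
    exists (fun z => mem z a), (fun z => mem z (fun N => ~ a N)).
    split; [|split; [|split; [|split]]].
    + intros z Hz. now exists a.
    + intros z Hz. now exists (fun N => ~ a N).
    + exact Hx.
    + now apply mem_not.
    + intros z [h1 h2]. apply mem_not in h2; auto.
  - intros n m H.
    assert (M : mem (principal m) (fun N => N = n)).
    { rewrite <- H. split; auto. apply gen_sing. }
    symmetry. apply M.
  - intros n x ->. exists (fun N => N = n). split.
    + split; auto. apply gen_sing.
    + intros y Hy. symmetry. now apply mem_sing.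
  - intros U HU [x Hx]. destruct (HU x Hx) as [a [Ha HaU]].
    destruct (mem_ex x a Ha) as [n Hn]. exists (principal n). split; [|now exists n].
    apply HaU. split; auto. now apply (mem_gen x).
Qed.

(** * The remainder and its clopen sets *)

Definition remainder (x : stone) : Prop := forall n, principal n <> x.

Lemma remainder_fin x a : remainder x -> fin a -> ~ mem x a.
Proof.
  intros Hx [B HB]. revert a HB. induction B as [|B IH]; intros a HB Ha.
  - destruct (mem_ex x a Ha) as [N HN]. specialize (HB N HN). lia.
  - destruct (mem_em x (fun N => N = B) (gen_sing S B)) as [H|H].
    + apply (Hx B). now apply mem_sing.
    + apply (IH _) with (2 := mem_and x _ _ Ha H). intros N [h1 h2].
      specialize (HB N h1). lia.
Qed.

(** Finite intersections from [F] are infinite, so they still meet every final segment of the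
    integers; adding these segments keeps the resulting point from being principal. *)
Lemma remainder_extend (F : (nat -> Prop) -> Prop) :
  (forall l, (forall a, In a l -> F a) -> ~ fin (fun N => forall a, In a l -> a N)) ->
  exists x : stone, remainder x /\ forall a, F a -> gen S a -> mem x a.
Proof.
  intros HF.
  destruct (stone_extend (fun a => F a \/ exists n, a = (fun N => (n <= N)%nat))) as [x Hx].
  - intros l Hl. apply NNPP. intros HN.
    assert (E : exists l' B, (forall a, In a l' -> F a) /\
      forall N, (B <= N)%nat -> (forall a, In a l' -> a N) -> forall a, In a l -> a N).
    { clear HN. induction l as [|b l IH].
      - exists nil, 0%nat. split; [intros a []|]. intros N _ _ a [].
      - destruct IH as [l' [B [H1 H2]]]. { intros c Hc. apply Hl. now right. }
        destruct (Hl b (or_introl eq_refl)) as [Hb|[n ->]].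
        + exists (b :: l'), B. split.
          * intros a [<-|Ha]; auto.
          * intros N HN H a [<-|Ha]; [apply H; now left|]. apply (H2 N HN); auto.
            intros c Hc. apply H. now right.
        + exists l', (max n B). split; auto.
          intros N HN H a [<-|Ha]; [lia|]. apply (H2 N); auto. lia. }
    destruct E as [l' [B [H1 H2]]]. apply (HF l' H1). exists B. intros N H.
    apply NNPP. intros L. apply HN. exists N. apply (H2 N); auto. lia.
  - exists x. split.
    + intros n Hn.
      assert (H : mem x (fun N => (Datatypes.S n <= N)%nat)).
      { apply Hx; [right; eauto|].
        replace (fun N => (Datatypes.S n <= N)%nat) with (fun N => ~ (N < Datatypes.S n)%nat)
          by (apply pred_ext; intros; lia).
        apply (gen_not S (fun N => (N < Datatypes.S n)%nat)), gen_fin. now exists (Datatypes.S n). }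
      rewrite <- Hn in H. destruct H as [_ H]. lia.
    + intros a Fa. apply Hx. now left.
Qed.

Lemma remainder_infinite a : gen S a -> ~ fin a -> exists x, remainder x /\ mem x a.
Proof.
  intros Ha Hf. destruct (remainder_extend (fun b => b = a)) as [x [Hx H]].
  - intros l Hl Hl'. apply Hf. eapply fin_sub; [|apply Hl']. intros N HN b Hb.
    now rewrite (Hl b Hb).
  - exists x. auto.
Qed.

Definition trace (a : nat -> Prop) : {x | remainder x} -> Prop :=
  fun y => mem (proj1_sig y) a.

Definition trace_alg (B : {x | remainder x} -> Prop) : Prop :=
  exists a, gen S a /\ B = trace a.

Lemma remainder_top : subspace_top stone_op remainder = alg_open _ trace_alg.
Proof.
  apply pred_ext. intros V. split.
  - intros [U [HU HV]] y Hy. destruct (HU (proj1_sig y)) as [a [Ha HaU]]; [now apply HV|].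
    exists (trace a). split; [|split].
    + exists a. split; auto. now apply (mem_gen (proj1_sig y)).
    + exact Ha.
    + intros z Hz. apply HV, HaU, Hz.
  (* The largest candidate is taken: the union of all basic sets whose trace lies in [V]. *)
  - intros HV. exists (fun x => exists a, mem x a /\ forall y, trace a y -> V y). split.
    + intros x [a [Ha H]]. exists a. split; auto. intros y Hy. now exists a.
    + intros y. split.
      * intros Hy. destruct (HV y Hy) as [B [[a [Ha ->]] [Hay HB]]]. now exists a.
      * intros [a [Ha H]]. now apply H.
Qed.

Lemma trace_alg_compact B (F : ({x | remainder x} -> Prop) -> Prop) : trace_alg B ->
  (forall D, F D -> trace_alg D) -> (forall y, B y -> exists D, F D /\ D y) ->
  exists l, (forall D, In D l -> F D) /\ forall y, B y -> exists D, In D l /\ D y.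
Proof.
  intros [a [Ha ->]] HF Hcov. apply NNPP. intros Hn.
  destruct (remainder_extend (fun c => c = a \/
    exists b, gen S b /\ F (trace b) /\ c = (fun N => ~ b N))) as [x [Hr Hx]].
  - intros l Hl Hfin. apply Hn.
    assert (E : exists lD, (forall D, In D lD -> F D) /\
      forall y, trace a y -> (exists D, In D lD /\ D y) \/
        forall c, In c l -> mem (proj1_sig y) c).
    { clear Hfin. induction l as [|c l IH].
      - exists nil. split; [intros D []|]. intros y _. right. intros c [].
      - destruct IH as [lD [H1 H2]]. { intros d Hd. apply Hl. now right. }
        destruct (Hl c (or_introl eq_refl)) as [->|[b [Hb [Fb ->]]]].
        + exists lD. split; auto. intros y Hy. destruct (H2 y Hy) as [|H]; auto.
          right. intros d [<-|Hd]; auto.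
        + exists (trace b :: lD). split.
          * intros D [<-|HD]; auto.
          * intros y Hy. destruct (H2 y Hy) as [[D [HD HDy]]|H].
            -- left. exists D. split; auto. now right.
            -- destruct (mem_em (proj1_sig y) b Hb) as [h|h].
               ++ left. exists (trace b). split; auto. now left.
               ++ right. intros d [<-|Hd]; auto. }
    destruct E as [lD [H1 H2]]. exists lD. split; auto. intros y Hy.
    destruct (H2 y Hy) as [|H]; auto. exfalso.
    exact (remainder_fin _ _ (proj2_sig y) Hfin (mem_list _ l H)).
  - destruct (Hcov (exist _ x Hr)) as [D [FD HD]].
    { apply Hx; auto. }
    destruct (HF D FD) as [b [Hb ->]].
    assert (Hnb : mem x (fun N => ~ b N)).
    { apply Hx; [|now apply gen_not]. right. now exists b. }
    apply mem_not in Hnb; auto.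
Qed.

(** An infinite difference would belong to some point of the remainder, which would lie in one trace
    and not in the other. *)
Lemma trace_sub_fin a b : gen S a -> gen S b ->
  (forall y, trace a y -> trace b y) -> fin (fun N => a N /\ ~ b N).
Proof.
  intros Ha Hb H. apply NNPP. intros Hf.
  destruct (remainder_infinite _ (gen_diff S a b Ha Hb) Hf) as [x [Hr Hx]].
  apply mem_diff in Hx; auto. destruct Hx as [h1 h2].
  apply h2. apply (H (exist _ x Hr)). exact h1.
Qed.

(** An arbitrary representative may be used: sets with the same trace differ by a finite set, which
    has density zero. *)
Definition trace_mu (B : {x | remainder x} -> Prop) : R :=
  mu (epsilon (inhabits (fun _ : nat => True)) (fun a => gen S a /\ B = trace a)).

Hypothesis S_appr : forall a, S a -> appr a.
Hypothesis S_null_fin : forall a, gen S a -> mu a = 0 -> fin a.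

Lemma mu_trace_le a b : gen S a -> gen S b ->
  (forall y, trace a y -> trace b y) -> mu a <= mu b.
Proof.
  intros Ha Hb H.
  pose proof (gen_appr S a S_appr Ha). pose proof (gen_appr S b S_appr Hb).
  pose proof (trace_sub_fin a b Ha Hb H) as Hf.
  apply Rle_trans with (mu (fun N => b N \/ (a N /\ ~ b N))).
  - apply mu_mono; auto using appr_or, appr_fin. intros N HN.
    destruct (classic (b N)); auto.
  - eapply Rle_trans; [apply mu_or_le; auto using appr_fin|]. rewrite (mu_fin _ Hf). lra.
Qed.

Lemma trace_mu_eq a : gen S a -> trace_mu (trace a) = mu a.
Proof.
  intros Ha. unfold trace_mu.
  destruct (epsilon_spec (inhabits (fun _ : nat => True))
    (fun b => gen S b /\ trace a = trace b)) as [H1 H2]; [now exists a|].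
  set (b := epsilon _ _) in *.
  apply Rle_antisym; apply mu_trace_le; auto; intros y Hy; congruence.
Qed.

Lemma trace_or a b : gen S a -> gen S b ->
  (fun y => trace a y \/ trace b y) = trace (fun N => a N \/ b N).
Proof. intros Ha Hb. apply pred_ext. intros y. symmetry. now apply mem_or. Qed.

Lemma trace_diff a b : gen S a -> gen S b ->
  (fun y => trace a y /\ ~ trace b y) = trace (fun N => a N /\ ~ b N).
Proof. intros Ha Hb. apply pred_ext. intros y. symmetry. now apply mem_diff. Qed.

Lemma trace_true : (fun _ => True) = trace (fun _ => True).
Proof. apply pred_ext. intros y. split; auto. intros _. apply mem_true. Qed.

Lemma remainder_measure : exists m,
  borel_prob_measure (subspace_top stone_op remainder) m /\
  regular_measure (subspace_top stone_op remainder) m /\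
  strictly_positive (subspace_top stone_op remainder) m.
Proof.
  rewrite remainder_top.
  assert (Afull : trace_alg (fun _ => True)).
  { exists (fun _ => True). split; [apply gen_true|apply trace_true]. }
  assert (Aor : forall A B, trace_alg A -> trace_alg B -> trace_alg (fun y => A y \/ B y)).
  { intros A B [a [Ha ->]] [b [Hb ->]]. rewrite trace_or by auto.
    exists (fun N => a N \/ b N). split; auto using gen_or. }
  assert (Adiff : forall A B, trace_alg A -> trace_alg B -> trace_alg (fun y => A y /\ ~ B y)).
  { intros A B [a [Ha ->]] [b [Hb ->]]. rewrite trace_diff by auto.
    exists (fun N => a N /\ ~ b N). split; auto using gen_diff. }
  assert (Mfull : trace_mu (fun _ => True) = 1).
  { rewrite trace_true, trace_mu_eq by apply gen_true. apply mu_full. }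
  assert (Mpos : forall A, trace_alg A -> 0 <= trace_mu A).
  { intros A [a [Ha ->]]. rewrite trace_mu_eq by auto. apply mu_nonneg.
    now apply (gen_appr S). }
  assert (Madd : forall A B, trace_alg A -> trace_alg B ->
    (forall y, A y -> B y -> False) -> trace_mu (fun y => A y \/ B y) = trace_mu A + trace_mu B).
  { intros A B [a [Ha ->]] [b [Hb ->]] Hd. rewrite trace_or by auto.
    assert (Hf : fin (fun N => a N /\ b N)).
    { replace (fun N => a N /\ b N) with (fun N => a N /\ ~ ~ b N)
        by (apply pred_ext; intros N; destruct (classic (b N)); tauto).
      apply trace_sub_fin; auto using gen_not. intros y Hy. apply mem_not; auto.
      intros h. eauto. }
    pose proof (gen_appr S a S_appr Ha). pose proof (gen_appr S b S_appr Hb).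
    (* Disjoint traces only make [a] and [b] almost disjoint; removing the finite common part does
       not change the measure of [b]. *)
    assert (Hb' : mu b = mu (fun N => b N /\ ~ a N)).
    { replace b with (fun N => (a N /\ b N) \/ (b N /\ ~ a N)) at 1
        by (apply pred_ext; intros N; destruct (classic (a N)); tauto).
      rewrite mu_add, (mu_fin _ Hf); auto using appr_and, appr_not; [lra|tauto]. }
    rewrite !trace_mu_eq, Hb' by auto using gen_or.
    rewrite <- mu_add; auto using appr_and, appr_not; [|tauto].
    f_equal. apply pred_ext. intros N. destruct (classic (a N)); tauto. }
  exists (outer _ trace_alg trace_mu). split; [|split].
  - apply outer_prob; auto. apply trace_alg_compact.
  - apply outer_regular; auto. apply trace_alg_compact.
  - apply outer_strictly_positive; auto; try apply trace_alg_compact.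
    intros A [a [Ha ->]] [y Hy]. rewrite trace_mu_eq by auto.
    destruct (mu_nonneg a) as [h|h]; auto.
    + now apply (gen_appr S).
    (* A null member of the algebra is finite, so no point of the remainder contains it. *)
    + exfalso. apply (remainder_fin _ a (proj2_sig y)); auto.
Qed.

(** * The map from the Stone space to the Cantor space *)

Definition point_of (x : stone) : cantor := fun i =>
  if excluded_middle_informative (mem x (fun N => bits N i = true)) then true else false.

Lemma mem_point_of x n : mem x (fun N => agree (bits N) (point_of x) n).
Proof.
  induction n as [|n IH].
  - apply (mem_up x _ _ (mem_true x)).
    + apply (gen_dep S 0). intros N N' _ H i Hi. lia.
    + intros N _ i Hi. lia.
  - assert (Hn : mem x (fun N => bits N n = point_of x n)).
    { unfold point_of. destruct excluded_middle_informative as [h|h]; auto.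
      apply mem_not in h; [|apply gen_bit]. apply (mem_up x _ _ h).
      - apply (gen_dep S (Datatypes.S n)). intros N N' H. now rewrite (H n) by lia.
      - intros N. apply Bool.not_true_iff_false. }
    apply (mem_up x _ _ (mem_and x _ _ IH Hn)).
    + apply (gen_dep S (Datatypes.S n)). intros N N' H H' i Hi.
      rewrite <- (H i Hi). now apply H'.
    + intros N [h1 h2] i Hi. destruct (Nat.eq_dec i n) as [->|]; auto. apply h1. lia.
Qed.

(** A point of the remainder contains all final segments of the integers and all digit
    neighbourhoods of its image, hence the tail around any [c] through that image. *)
Lemma remainder_mem_close x c n Y : remainder x -> c (point_of x) ->
  gen S Y -> (forall N, close_tail c n N -> Y N) -> mem x Y.
Proof.
  intros Hr Hc HY H.
  assert (Hf : mem x (fun N => ~ (N < 2 ^ n)%nat)).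
  { assert (F : fin (fun N => (N < 2 ^ n)%nat)) by now exists (2 ^ n)%nat.
    apply mem_not; [now apply gen_fin|]. now apply remainder_fin. }
  apply (mem_up x _ _ (mem_and x _ _ Hf (mem_point_of x n))); auto.
  intros N [h1 h2]. apply H. split; [lia|]. exists (point_of x). auto.
Qed.

End Stone.

(** * The compactification and the failure of separability *)

Theorem theorem1p1 :
  hyp_star ->
  exists (X : Type) (op : (X -> Prop) -> Prop) (e : nat -> X),
    compactification_of_omega op e /\
    let rem := fun x : X => forall n, e n <> x in
    ~ separable (subspace_top op rem) /\
    exists mu : ({x | rem x} -> Prop) -> R,
      borel_prob_measure (subspace_top op rem) mu /\
      regular_measure (subspace_top op rem) mu /\
      strictly_positive (subspace_top op rem) mu.
Proof.
  intros [K [[c [[HE Hcov] _]] [J [js [[Hcnt Hcof] HJ]]]]].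
  apply choice in Hcov. destruct Hcov as [ch Hch].
  apply choice in Hcnt. destruct Hcnt as [en Hen].
  (* [C j] lists the cover sets with index in [js j]. Where the enumeration [en j] gives no value,
     the cover set chosen for the zero sequence is inserted; being in the ideal, it does no harm. *)
  set (C := fun j k => c (match en j k with Some i => i | None => ch (fun _ => false) end)).
  destruct (small_well_order J) as [lt [Hwf [Htot [Htr Hsmall]]]].
  destruct (family_exists J lt Hwf Htot Htr C) as [Y [HY Hnull]].
  { intros j. now apply initial_segments_bounded. }
  { intros j k. apply HE. }
  set (S := fun a => exists j, a = Y j).
  assert (HS : forall a, S a -> appr a). { intros a [j ->]. apply HY. }
  exists (stone S), (stone_op S), (principal S).
  split; [apply stone_compactification|]. simpl.
  split; [|now apply remainder_measure].
  intros [s Hs].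
  (* For each point of the supposed dense sequence the index of a cover set through its image is
     taken; this countable set of indices is contained in a single [js j]. *)
  destruct (Hcof (fun k => exists n y, s n = Some y /\
    k = ch (point_of S (proj1_sig y)))) as [j Hj].
  { exists (fun n => option_map (fun y => ch (point_of S (proj1_sig y))) (s n)).
    intros k [n [y [Hn ->]]]. exists n. now rewrite Hn. }
  assert (GY : gen S (Y j)). { apply gen_base. now exists j. }
  destruct (HY j) as [AY [MY [f Hf]]].
  (* Were the complement finite, [Y j] would have measure 1 instead of at most one half. *)
  assert (Hinf : ~ fin (fun N => ~ Y j N)).
  { intros F. assert (M : mu (fun N => Y j N \/ ~ Y j N) = 1).
    { rewrite <- mu_full. f_equal. apply pred_ext. intros N. split; auto.
      intros _. apply classic. }
    rewrite mu_add, (mu_fin _ F) in M; auto using appr_not. lra. }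
  destruct (remainder_infinite S _ (gen_not _ _ GY) Hinf) as [x [Hr Hx]].
  destruct (Hs (trace S (fun N => ~ Y j N))) as [y [Hy [n Hn]]].
  - exists (fun z => mem S z (fun N => ~ Y j N)). split; [|reflexivity].
    intros z Hz. exists (fun N => ~ Y j N). auto.
  - now exists (exist _ x Hr).
  (* The point [y] of the sequence in the trace of the complement of [Y j] lies over a cover set
     listed in [C j], so it contains [Y j] as well. *)
  - apply mem_not in Hy; auto. apply Hy.
    set (p := point_of S (proj1_sig y)).
    assert (Hp : js j (ch p)). { apply Hj. now exists n, y. }
    destruct (Hen j _ Hp) as [k Hk].
    apply (remainder_mem_close S _ (C j k) (f k)); auto.
    + exact (proj2_sig y).
    + unfold C. rewrite Hk. apply Hch.
    + apply Hf.
Qed.
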